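(* Let $N=1$ and $1<q<p<+\infty$. Then $$\lambda_1(q)<\frac{\|\varphi_p'\|_q^q}{\|\varphi_p\|_q^q}<\lambda_2(q).$$
   Context: Here $\Omega=(0,T)$ with $T>0$, and $\|\cdot\|_r$ is the norm of $L^r(0,T)$. For $r>1$ consider the Dirichlet eigenvalue problem $-(|u'|^{r-2}u')'=\lambda|u|^{r-2}u$ in $(0,T)$, $u(0)=u(T)=0$. Its eigenvalues are exactly $\lambda_k(r)=(r-1)\left(\frac{k\pi_r}{T}\right)^r$, $k\in\mathbb{N}=\{1,2,\dots\}$, with $\pi_r=\frac{2\pi}{r\sin(\pi/r)}$. The first eigenfunction (corresponding to $\lambda_1(r)$, unique up to a nonzero multiplier) is $\varphi_r(t)=\sin_r(\pi_r t/T)$, where $\sin_r$ is the inverse function of $x\mapsto\int_0^x(1-s^r)^{-1/r}\,ds$, $x\in[0,1]$, extended periodically and anti-periodically from $[0,\pi_r/2]$ to $\mathbb{R}$ in the usual way (as for the sine function). *)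

(* Defs.v *)
From HB Require Import structures.
From mathcomp Require Import all_boot all_order all_algebra.
From mathcomp Require Import all_classical all_reals all_analysis.
Set Implicit Arguments.
Unset Strict Implicit.
Unset Printing Implicit Defensive.
Import Order.TTheory GRing.Theory Num.Theory.
Import numFieldNormedType.Exports.
Local Open Scope classical_set_scope.
Local Open Scope ring_scope.

(* The constant written pi_r in the literature. *)
Definition pip {R : realType} (r : R) : R := 2 * pi / (r * sin (pi / r)).

(* The integrand is singular at s = 1; there [powR] returns 0 (as 0 `^ a = 0
   for a <> 0), which is harmless since a point is Lebesgue-negligible. *)
Definition arcsinp {R : realType} (r x : R) : R :=
  \int[lebesgue_measure]_(s in `[0, x]) ((1 - s `^ r) `^ (- r^-1)).

(* For 1 < r, [arcsinp r] is a bijection from [0, 1] onto [0, pip r / 2], and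
   only the values of its inverse on the latter interval are used below. *)
Definition sinp_quarter {R : realType} (r : R) : R -> R :=
  'pinv_(fun=> 0) `[0, 1] (arcsinp r).

(* Write t = k * pip r + s with k an integer and 0 <= s < pip r. On
   [0, pip r] the function is symmetric about pip r / 2, and each shift by
   pip r changes the sign. *)
Definition sinp {R : realType} (r t : R) : R :=
  let k := Num.floor (t / pip r) in
  let s := t - k%:~R * pip r in
  (-1) ^ k * sinp_quarter r (Num.min s (pip r - s)).

(* The k-th Dirichlet eigenvalue (k >= 1) of
   - (|u'|^(r-2) u')' = lambda |u|^(r-2) u on (0, T). *)
Definition lambda_ {R : realType} (T : R) (k : nat) (r : R) : R :=
  (r - 1) * (k%:R * pip r / T) `^ r.

(* The eigenfunction for [lambda_ T 1 r]. *)
Definition phi {R : realType} (T r t : R) : R := sinp r (pip r * t / T).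

(* The norm of L^r(0, T), computed on the extension by 0 outside (0, T). *)
Definition norm_Lr {R : realType} (T r : R) (f : R -> R) : \bar R :=
  'N[lebesgue_measure]_(r%:E)[EFin \o (f \_ `]0, T[)].

(* Main.v *)
Require Import Defs.
From mathcomp Require Import all_boot all_order all_algebra.
From mathcomp Require Import all_classical all_reals all_analysis.
From mathcomp Require Import measurable_realfun ring lra.
Import Order.TTheory GRing.Theory Num.Theory.
Import numFieldNormedType.Exports.
Local Open Scope ring_scope.
Set Implicit Arguments.
Unset Strict Implicit.
Unset Printing Implicit Defensive.

(** Let c_r = pi_r / T, let u = phi_p and v = phi_q on the increasing half
    [0, T/2] of the arch, and let R be the quotient to be bounded; by symmetry
    R = int u'^q / int u^q over [0, T/2].

    Lower bound (Picone): g = (v'/v)^(q-1) solves the Riccati equation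
    g' = - (q-1) c_q^q v^(-q), so by Young's inequality
    int_0^t (u'^q - lambda_1(q) u^q) - u^q g is nondecreasing in t. It tends to 0
    at 0, and if it vanished identically then u'/u = v'/v, hence u = v,
    contradicting u'(0) = c_p < c_q = v'(0).

    Upper bound: u' < c_p and u(T/2) = 1 give int u'^q < c_p^(q-1), while
    concavity gives u >= 2t/T, so that R < 2 (q+1) c_p^(q-1) / T. This is at most
    lambda_2(q) because pi_p < pi_q, (q-1) pi_q >= 2 and q + 1 <= 2^q.

    That int_0^1 (1-s^r)^(-1/r) ds is pi_r / 2 for the closed form of pi_r used in
    the definitions is the reflection formula: the integral equals 1/r times the
    alternating series sum_k (-1)^k / (1/r + k), summed to pi / sin(pi/r) with the
    Fejer kernel. *)

(** * Rules for derivatives and comparison of functions through their derivatives *)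

Section Derivatives.
Context {R : realType}.
Implicit Types (f g : R -> R) (x a b c : R).

Lemma is_derive1D f g x a b : is_derive x 1 f a -> is_derive x 1 g b ->
  is_derive x 1 (fun t => f t + g t) (a + b).
Proof. by move=> df dg; exact: is_deriveD. Qed.

Lemma is_derive1B f g x a b : is_derive x 1 f a -> is_derive x 1 g b ->
  is_derive x 1 (fun t => f t - g t) (a - b).
Proof. by move=> df dg; exact: is_deriveB. Qed.

Lemma is_derive1M f g x a b : is_derive x 1 f a -> is_derive x 1 g b ->
  is_derive x 1 (fun t => f t * g t) (a * g x + f x * b).
Proof.
move=> df dg; have := is_deriveM df dg.
by rewrite addrC /GRing.scale/= [g x * a]mulrC.
Qed.

Lemma is_derive1Z f x a c : is_derive x 1 f a ->
  is_derive x 1 (fun t => c * f t) (c * a).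
Proof. by move=> df; exact: is_deriveZ. Qed.

Lemma is_derive1_composite f g x a b :
  is_derive (g x) 1 f a -> is_derive x 1 g b ->
  is_derive x 1 (fun t => f (g t)) (a * b).
Proof. by move=> df dg; exact: is_derive1_comp. Qed.

Lemma is_derive1_powR_comp g x b p : 0 < g x -> is_derive x 1 g b ->
  is_derive x 1 (fun t => g t `^ p) (p * g x `^ (p - 1) * b).
Proof.
by move=> gx dg; exact: is_derive1_composite (is_derive1_powR p gx) dg.
Qed.

Lemma is_derive1_cBid x c : is_derive x 1 (fun t => c - t) (- 1).
Proof.
by rewrite -sub0r; exact: is_derive1B (is_derive_cst c x 1) (is_derive_id x 1).
Qed.

Lemma is_derive1_sum n (h : 'I_n -> R -> R) (dh : 'I_n -> R) x :
  (forall i, is_derive x 1 (h i) (dh i)) ->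
  is_derive x 1 (fun t => \sum_(i < n) h i t) (\sum_(i < n) dh i).
Proof.
move=> dhE; have := is_derive_sum dhE.
by congr is_derive; apply/funext => t; rewrite fct_sumE.
Qed.

Lemma is_derive1_scale x c : is_derive x 1 (fun t => c * t) c.
Proof.
by have := is_derive1Z c (is_derive_id x (1 : R)); rewrite mulr1.
Qed.

Lemma is_derive1_eq_near f g x a : (\forall t \near x, f t = g t) ->
  is_derive x 1 f a -> is_derive x 1 g a.
Proof.
move=> fg [df <-]; split; first exact: near_eq_derivable fg df.
by apply/esym/near_eq_derive => //; exact: oner_neq0.
Qed.

Lemma is_derive1_continuous f x a : is_derive x 1 f a ->
  {for x, continuous f}.
Proof.
move=> [df _]; exact/differentiable_continuous/derivable1_diffP.
Qed.

Lemma is_derive1_within_continuous f (df : R -> R) a b :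
  (forall x, x \in `[a, b] -> is_derive x 1 f (df x)) ->
  {within `[a, b], continuous f}%classic.
Proof.
move=> fd; apply: continuous_in_subspaceT => x /set_mem xab.
exact: is_derive1_continuous (fd _ xab).
Qed.

Lemma is_derive1_ge0_le f (df : R -> R) a b : a <= b ->
  (forall x, x \in `]a, b[ -> is_derive x 1 f (df x)) ->
  {within `[a, b], continuous f}%classic ->
  (forall x, x \in `]a, b[ -> 0 <= df x) -> f a <= f b.
Proof.
rewrite le_eqVlt => /predU1P[->//|ab] fd fc df0.
have [c cab fE] := MVT ab fd fc.
by rewrite -subr_ge0 fE mulr_ge0 ?df0// subr_ge0 ltW.
Qed.

Lemma is_derive1_gt0_lt f (df : R -> R) a b : a < b ->
  (forall x, x \in `]a, b[ -> is_derive x 1 f (df x)) ->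
  {within `[a, b], continuous f}%classic ->
  (forall x, x \in `]a, b[ -> 0 < df x) -> f a < f b.
Proof.
move=> ab fd fc df0; have [c cab fE] := MVT ab fd fc.
by rewrite -subr_gt0 fE mulr_gt0 ?df0// subr_gt0.
Qed.

(** The difference [g - f] is nondecreasing. Applied to primitives, this takes the place of
    estimates under the integral sign. *)
Lemma is_derive1_le_le f g (df dg : R -> R) a b : a <= b ->
  (forall x, x \in `]a, b[ -> is_derive x 1 f (df x)) ->
  (forall x, x \in `]a, b[ -> is_derive x 1 g (dg x)) ->
  {within `[a, b], continuous f}%classic ->
  {within `[a, b], continuous g}%classic ->
  (forall x, x \in `]a, b[ -> df x <= dg x) -> f b - f a <= g b - g a.
Proof.
move=> ab fd gd fc gc le_d.
suff : g a - f a <= g b - f b by lra.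
apply: (@is_derive1_ge0_le (fun t => g t - f t) (fun t => dg t - df t)) => //.
- by move=> x xab; apply: is_derive1B; [exact: gd|exact: fd].
- by move=> x; apply: continuousB; [exact: gc|exact: fc].
- by move=> x xab; rewrite subr_ge0 le_d.
Qed.

Lemma is_derive1_norm_le f g (df dg : R -> R) a b : a <= b ->
  (forall x, x \in `]a, b[ -> is_derive x 1 f (df x)) ->
  (forall x, x \in `]a, b[ -> is_derive x 1 g (dg x)) ->
  {within `[a, b], continuous f}%classic ->
  {within `[a, b], continuous g}%classic ->
  (forall x, x \in `]a, b[ -> `|df x| <= dg x) -> `|f b - f a| <= g b - g a.
Proof.
move=> ab fd gd fc gc le_d; rewrite ler_norml; apply/andP; split; last first.
  by apply: is_derive1_le_le fd gd fc gc _ => // x /le_d; rewrite ler_norml => /andP[].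
have : (- f b) - (- f a) <= g b - g a; last by lra.
apply: (@is_derive1_le_le (fun t => - f t) _ (fun t => - df t) dg) => //.
- by move=> x xab; apply: is_deriveN; exact: fd.
- by move=> x; apply: continuousN; exact: fc.
- by move=> x /le_d; rewrite ler_norml => /andP[+ _]; lra.
Qed.

End Derivatives.

(** * Continuity within a set and primitives of continuous functions *)

Section WithinContinuity.
Context {R : realType}.
Local Open Scope classical_set_scope.

(** Continuity of [g] is asked only relative to [B]: the functions composed below, such as
    [arcsinp r] on [0, 1], are controlled only on a segment. *)
Lemma within_continuous_comp_sub (A B : set R) (f g : R -> R) :
  {within A, continuous f} -> {within B, continuous g} ->
  (forall x, A x -> B (f x)) -> {within A, continuous (g \o f)}.
Proof.
rewrite !subspace_continuousP => cf cg fAB x Ax V /(cg _ (fAB _ Ax))/= h.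
have {}h : nbhs x (fun y => A y -> B (f y) -> V (g (f y))) := cf x Ax _ h.
suff : nbhs x (fun y => A y -> V (g (f y))) by [].
by apply: filterS h => y hy Ay; exact: hy Ay (fAB _ Ay).
Qed.

Lemma within_continuous_sum (A : set R) n (h : 'I_n -> R -> R) :
  (forall i, {within A, continuous (h i)}) ->
  {within A, continuous (fun x => \sum_(i < n) h i x)}.
Proof.
elim: n h => [|n IH] h hc.
  apply: (@subspace_eq_continuous _ _ _ (fun=> 0)).
    by move=> x _; rewrite /from_subspace big_ord0.
  exact/continuous_subspaceT/cst_continuous.
apply: (@subspace_eq_continuous _ _ _
  (fun x => \sum_(i < n) h (widen_ord (leqnSn n) i) x + h ord_max x)).
  by move=> x _; rewrite /from_subspace big_ord_recr.
by move=> x; apply: continuousD; [exact: IH|exact: hc].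
Qed.

Lemma within_continuousMl (A : set R) k (f : R -> R) :
  {within A, continuous f} -> {within A, continuous (fun x => k * f x)}.
Proof.
by move=> fc x; apply: continuousM; [exact: cst_continuous|exact: fc].
Qed.

Lemma within_continuousD (A : set R) (f g : R -> R) :
  {within A, continuous f} -> {within A, continuous g} ->
  {within A, continuous (fun x => f x + g x)}.
Proof. by move=> fc gc x; apply: continuousD; [exact: fc|exact: gc]. Qed.

Lemma within_continuousM (A : set R) (f g : R -> R) :
  {within A, continuous f} -> {within A, continuous g} ->
  {within A, continuous (fun x => f x * g x)}.
Proof. by move=> fc gc x; apply: continuousM; [exact: fc|exact: gc]. Qed.

Lemma within_continuousN (A : set R) (f : R -> R) :
  {within A, continuous f} -> {within A, continuous (fun x => - f x)}.
Proof. by move=> fc x; apply: continuousN; exact: fc. Qed.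

Lemma within_continuous_cst (A : set R) (c : R) :
  {within A, continuous (fun=> c)}.
Proof. by move=> x; exact: cst_continuous. Qed.

Lemma within_continuous_id (A : set R) : {within A, continuous (fun x : R => x)}.
Proof. by apply: continuous_subspaceT => x; exact: cvg_id. Qed.

(** The fundamental theorem of calculus in the form that the comparison lemmas use: derivative
    inside, continuity up to the endpoints. *)
Lemma primitive_spec (f : R -> R) b : 0 < b ->
  {within `[0, b], continuous f} ->
  let F x := \int[lebesgue_measure]_(t in `[0, x]) f t in
  [/\ F 0 = 0, {within `[0, b], continuous F} &
      forall x, x \in `]0, b[%R -> is_derive x 1 F (f x)].
Proof.
move=> b0 fc F.
have fi : lebesgue_measure.-integrable `[0, b] (EFin \o f).
  by apply: continuous_compact_integrable => //; exact: segment_compact.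
split.
- by rewrite /F set_itv1 Rintegral_set1.
- exact: parameterized_integral_continuous (ltW b0) fi.
- move=> x xb; have [x0 xltb] : 0 < x /\ x < b.
    by move: xb; rewrite in_itv/= => /andP[].
  have [fx _ _] := (continuous_within_itvP f b0).1 fc.
  have [d dE] := continuous_FTC1_closed xltb fi x0 (fx x xb).
  apply: DeriveDef; first exact: d.
  by rewrite -derive1E; exact: dE.
Qed.

End WithinContinuity.

(** * The partial fraction expansion of the cosecant *)

Section Cosecant.
Context {R : realType}.
Implicit Types (a t : R).

(** The symmetric partial sums of pi / sin (pi a) = sum over all integers n of (-1)^n / (a + n), the
    terms n and -n being paired. *)
Definition csc_partial a N : R :=
  a^-1 + \sum_(i < N) (-1) ^+ i.+1 * ((a + i.+1%:R)^-1 + (a - i.+1%:R)^-1).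

Let dirichlet N t : R := 1 + 2 * \sum_(i < N) cos (i.+1%:R * t).

(** The sum telescopes, as 2 sin (t / 2) cos ((N + 1) t) is a difference of two consecutive
    right-hand sides. *)
Let dirichletE N t :
  sin (t / 2) * dirichlet N t = sin (t / 2 + N%:R * t).
Proof.
rewrite /dirichlet; elim: N => [|N IH]; first by rewrite big_ord0 !(mulr0, mul0r, addr0) mulr1.
rewrite big_ord_recr/= [2 * _]mulrDr addrA mulrDr IH.
have -> : t / 2 + N%:R * t = N.+1%:R * t - t / 2 by rewrite -natr1; field.
rewrite sinB [X in _ = sin X]addrC sinD; ring.
Qed.

Let fejerE M t :
  sin (t / 2) ^+ 2 * \sum_(N < M) dirichlet N t = sin (M%:R * t / 2) ^+ 2.
Proof.
elim: M => [|M IH]; first by rewrite big_ord0 !mul0r sin0 mulr0 expr0n.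
rewrite big_ord_recr/= mulrDr IH [sin (t / 2) ^+ 2]expr2 -[sin (t / 2) * _ * _]mulrA dirichletE.
(* With A = M t / 2 and B = (M + 1) t / 2, the new term is sin (B + A) sin (B - A) = sin^2 B - sin^2
   A. *)
have -> : t / 2 + M%:R * t = M%:R * t / 2 + M.+1%:R * t / 2.
  by rewrite -natr1; field.
have -> : t / 2 = M.+1%:R * t / 2 - M%:R * t / 2 by rewrite -natr1; field.
rewrite sinB sinD.
move: (cos2Dsin2 (M.+1%:R * t / 2)) (cos2Dsin2 (M%:R * t / 2)).
move: (cos (M.+1%:R * t / 2)) (sin (M.+1%:R * t / 2)) => c s.
move: (cos (M%:R * t / 2)) (sin (M%:R * t / 2)) => c' s' e e'.
transitivity (s' ^+ 2 * (1 - c ^+ 2) + s ^+ 2 * c' ^+ 2); first by ring.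
have -> : 1 - c ^+ 2 = s ^+ 2 by lra.
by rewrite -mulrDl addrC -mulrDl e' mul1r || (rewrite mulrC -mulrDr addrC e' mulr1).
Qed.

(** The primitive of [(cos (a * t) - 1) * dirichlet N t] that vanishes at 0, with products of
    cosines turned into sums. At pi it is the error [sin (a * pi) * csc_partial a N - pi]. *)
Let D a N t : R := sin (a * t) / a - t +
  \sum_(i < N) (sin ((a + i.+1%:R) * t) / (a + i.+1%:R)
     + sin ((a - i.+1%:R) * t) / (a - i.+1%:R)
     - 2 * (sin (i.+1%:R * t) / i.+1%:R)).

Let dsin (c t : R) : c != 0 -> is_derive t 1 (fun t => sin (c * t) / c) (cos (c * t)).
Proof.
move=> c0; have := is_derive1Z c^-1
  (is_derive1_composite (is_derive_sin (c * t)) (is_derive1_scale t c)).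
by congr is_derive; [apply/funext => x; rewrite mulrC|rewrite mulrCA mulVf// mulr1].
Qed.

Let dD a N t : 0 < a -> a < 1 ->
  is_derive t 1 (D a N) ((cos (a * t) - 1) * dirichlet N t).
Proof.
move=> a0 a1; have a_neq i : a - i.+1%:R != 0.
  by rewrite subr_eq0 lt_eqF// (lt_le_trans a1)// ler1n.
have aDneq i : a + i.+1%:R != 0 by rewrite gt_eqF// addr_gt0.
have h i := is_derive1B (is_derive1D (dsin t (aDneq i)) (dsin t (a_neq i)))
  (is_derive1Z 2 (dsin t (lt0r_neq0 (ltr0Sn R i)))).
have := is_derive1D (is_derive1B (dsin t (lt0r_neq0 a0)) (is_derive_id t (1:R)))
  (@is_derive1_sum R N _ _ t (fun i => h i)); congr is_derive.
rewrite /dirichlet mulrDr mulr1 mulrCA mulr_sumr mulr_sumr; congr (_ + _).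
apply: eq_bigr => i _; rewrite mulrDl mulrBl cosD cosB; ring.
Qed.

Let D0 a N : D a N 0 = 0.
Proof.
rewrite /D !mulr0 sin0 mul0r subr0 add0r big1// => i _.
by rewrite !mulr0 sin0 !mul0r mulr0 subr0 addr0.
Qed.

Let sinDnpi (x : R) n : sin (x + n%:R * pi) = (-1) ^+ n * sin x.
Proof.
elim: n => [|n IH]; first by rewrite mul0r addr0 expr0 mul1r.
by rewrite -natr1 mulrDl mul1r addrA sinD cospi sinpi mulr0 addr0 IH exprS; ring.
Qed.

Let Dpi a N : D a N pi = sin (a * pi) * csc_partial a N - pi.
Proof.
rewrite /D /csc_partial [sin (a * pi) * (_ + _)]mulrDr mulr_sumr addrAC; congr (_ + _ - _).
apply: eq_bigr => i _.
have := sinDnpi 0 i.+1; rewrite add0r sin0 mulr0 => ->.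
have := sinDnpi (a * pi) i.+1; rewrite -mulrDl => ->.
have : sin ((a - i.+1%:R) * pi) = (-1) ^+ i.+1 * sin (a * pi).
  rewrite -[in RHS](subrK i.+1%:R a) (mulrDl _ i.+1%:R) sinDnpi mulrA.
  by rewrite -exprD addnn -mul2n exprM sqrrN expr1n expr1n mul1r.
by move=> ->; rewrite mul0r mulr0 subr0; ring.
Qed.

(* The average of the Dirichlet kernels is the Fejer kernel, whose singularity
   at 0 is cancelled by [1 - cos (a * t) <= 1 - cos t = 2 * sin (t / 2) ^+ 2]. *)
Let csc_mean a M : 0 < a -> a < 1 ->
  `|\sum_(N < M) (sin (a * pi) * csc_partial a N - pi)| <= 2 * pi.
Proof.
move=> a0 a1; under eq_bigr do rewrite -Dpi.
pose B t := \sum_(N < M) D a N t.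
have dB t : is_derive t 1 B ((cos (a * t) - 1) * \sum_(N < M) dirichlet N t).
  rewrite mulr_sumr; apply: is_derive1_sum => i; exact: dD.
have B0 : B 0 = 0 by rewrite /B big1// => N _; exact: D0.
have -> : \sum_(N < M) D a N pi = B pi - B 0 by rewrite B0 subr0.
have -> : 2 * pi = 2 * pi - 2 * 0 :> R by rewrite mulr0 subr0.
apply: (@is_derive1_norm_le R B ( *%R 2)
  (fun t => (cos (a * t) - 1) * \sum_(N < M) dirichlet N t) (fun=> 2)).
- exact: pi_ge0.
- by move=> x _; exact: is_derive1_scale.
- by apply: is_derive1_within_continuous => x _; exact: dB.
- apply: (@is_derive1_within_continuous R ( *%R 2) (fun=> 2)) => x _; exact: is_derive1_scale.
- move=> t; rewrite in_itv/= => /andP[t0 tpi].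
  have sum_ge0 : 0 <= \sum_(N < M) dirichlet N t.
    have s0 : 0 < sin (t / 2) by apply: sin_gt0_pi; lra.
    by rewrite -(pmulr_rge0 _ (exprn_gt0 2 s0)) fejerE sqr_ge0.
  have cosle : cos t <= cos (a * t).
    have [->//|/eqP] := eqVneq (a * t) t.
    by move=> _; apply: ltW; rewrite ltr_cos ?in_itv/=; nra.
  rewrite ler0_norm ?mulr_le0_ge0 ?subr_le0 ?cos_le1//.
  apply: (@le_trans _ _ ((1 - cos t) * \sum_(N < M) dirichlet N t)).
    by rewrite -mulNr ler_wpM2r// opprB lerB.
  have -> : 1 - cos t = 2 * sin (t / 2) ^+ 2.
    have -> : t = (t / 2) *+ 2 by rewrite mulr2n; lra.
    rewrite cos_mulr2n.
    have := cos2Dsin2 ((t/2) *+ 2 / 2).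
    have -> : (t/2) *+ 2 / 2 = t / 2 by rewrite mulr2n; lra.
    by rewrite mulr2n; lra.
  rewrite -mulrA fejerE.
  have := cos2Dsin2 (M%:R * t / 2); have := sqr_ge0 (cos (M%:R * t / 2)); lra.
Qed.

(** The Cesaro means of a convergent sequence have the same limit, and by [csc_mean] the means of
    [sin (a * pi) * csc_partial a N] differ from pi by at most 2 pi / (n + 1). *)
Lemma csc_partial_lim a (l : R) : 0 < a -> a < 1 ->
  (csc_partial a @ \oo --> l)%classic -> sin (a * pi) * l = pi.
Proof.
move=> a0 a1 /cesaro cl.
have : (sin (a * pi) * arithmetic_mean (csc_partial a) n @[n --> \oo] -->
   sin (a * pi) * l)%classic.
  by apply: cvgMr.
move/cvg_lim => <-//.
apply/cvg_lim => //; apply/cvgrPdist_le => e e0.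
near=> n.
have n0 : 0 < n.+1%:R :> R by [].
have -> : pi - sin (a * pi) * arithmetic_mean (csc_partial a) n =
   - (\sum_(N < n.+1) (sin (a * pi) * csc_partial a N - pi)) / n.+1%:R.
  rewrite /arithmetic_mean/= seriesEord/= sumrB -mulr_sumr sumr_const card_ord.
  by rewrite -[pi *+ _]mulr_natl; field; rewrite gt_eqF.
rewrite normrM normrN normfV (gtr0_norm n0) ler_pdivrMr//.
apply: le_trans (csc_mean _ a0 a1) _.
rewrite -ler_pdivrMl// (@le_trans _ _ n%:R) ?ler_nat//.
by near: n; exact: nbhs_infty_ger.
Unshelve. all: by end_near. Qed.

End Cosecant.

(** * The inverse of the generalized sine *)

Section Arcsinp.
Context {R : realType}.
Implicit Types (r s x : R).
Local Open Scope classical_set_scope.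

(** The absolute value makes 0 an interior point of continuity; the derivative rule for powers does
    not reach it, so it is treated by hand. *)
Lemma continuous_norm_powR p : 0 < p -> continuous (fun x : R => `|x| `^ p).
Proof.
move=> p0 x; have [->|x0] := eqVneq x 0.
  rewrite /continuous_at normr0 powR0 ?gt_eqF//.
  apply/cvgrPdist_lt => e e0; near=> y.
  rewrite sub0r normrN ger0_norm ?powR_ge0//.
  have [->|y0] := eqVneq y 0; first by rewrite normr0 powR0 ?gt_eqF.
  have ye : `|y| < e `^ p^-1.
    near: y; have := @nbhs0_lt R R _ (powR_gt0 p^-1 e0); apply: filterS => //.
  rewrite -[ltRHS](powRr1 (ltW e0)) -(mulVf (lt0r_neq0 p0)) powRrM.
  by rewrite gt0_ltr_powR ?nnegrE ?powR_ge0.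
apply: (@continuous_comp _ _ _ (fun x : R => `|x|) (fun x => x `^ p)).
  exact: norm_continuous.
by apply: is_derive1_continuous (is_derive1_powR _ _); rewrite normr_gt0.
Unshelve. all: by end_near. Qed.

Lemma within_continuous_powR p a b : 0 < p -> 0 <= a ->
  {within `[a, b], continuous (fun x : R => x `^ p)}.
Proof.
move=> p0 a0; apply: (@subspace_eq_continuous _ _ _ (fun x : R => `|x| `^ p)).
  move=> x /set_mem/=; rewrite in_itv/= => /andP[ax _].
  by rewrite /= ger0_norm// (le_trans a0).
exact/continuous_subspaceT/continuous_norm_powR.
Qed.

Definition darcsinp r s : R := (1 - s `^ r) `^ (- r^-1).

Lemma powR_lt1 r x : 0 < r -> 0 <= x -> x < 1 -> x `^ r < 1.
Proof.
move=> r0 x0 x1; have := gt0_ltr_powR r0 x0 ler01 x1.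
by rewrite powR1; apply; rewrite nnegrE.
Qed.

Lemma powR_le1 r x : 0 < r -> 0 <= x <= 1 -> x `^ r <= 1.
Proof.
move=> r0 /andP[x0]; rewrite le_eqVlt => /predU1P[->|x1]; first by rewrite powR1.
exact/ltW/powR_lt1.
Qed.

Lemma darcsinp_gt0 r x : 0 < r -> 0 <= x -> x < 1 -> 0 < darcsinp r x.
Proof. by move=> r0 x0 x1; rewrite powR_gt0// subr_gt0 powR_lt1. Qed.

Lemma darcsinp_ge0 r x : 0 <= darcsinp r x.
Proof. exact: powR_ge0. Qed.

(** The even extension of [darcsinp r], continuous from both sides at 0. *)
Let darcsinp_abs r s : R := (1 - `|s| `^ r) `^ (- r^-1).

Let darcsinp_abs_cont r s : 0 < r -> `|s| < 1 ->
  {for s, continuous (darcsinp_abs r)}.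
Proof.
move=> r0 s1; apply: (@continuous_comp _ _ _ (fun x => 1 - `|x| `^ r)
  (fun x => x `^ (- r^-1))).
  apply: continuousB; first exact: cst_continuous.
  exact: continuous_norm_powR.
by apply: is_derive1_continuous (is_derive1_powR _ _); rewrite subr_gt0 powR_lt1.
Qed.

Lemma continuous_darcsinp r x : 0 < r -> 0 < x -> x < 1 ->
  {for x, continuous (darcsinp r)}.
Proof.
move=> r0 x0 x1; rewrite /prop_for /continuous_at.
have xE := gtr0_norm x0.
have -> : darcsinp r x = darcsinp_abs r x by rewrite /darcsinp_abs xE.
have h : darcsinp_abs r y @[y --> x] --> darcsinp_abs r x.
  by apply: darcsinp_abs_cont; rewrite ?xE.
apply: cvg_trans h; apply: near_eq_cvg; near=> y.
have y0 : 0 < y by near: y; exact: lt_nbhsr.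
by rewrite /darcsinp /darcsinp_abs (gtr0_norm y0).
Unshelve. all: by end_near. Qed.

Lemma within_continuous_darcsinp r x : 0 < r -> x < 1 ->
  {within `[0, x], continuous (darcsinp r)}.
Proof.
move=> r0 x1; apply: (@subspace_eq_continuous _ _ _ (darcsinp_abs r)).
  move=> y /set_mem/=; rewrite in_itv/= => /andP[y0 _].
  by rewrite /darcsinp_abs/from_subspace ger0_norm.
apply: continuous_in_subspaceT => y /set_mem/=; rewrite in_itv/= => /andP[y0 yx].
by apply: darcsinp_abs_cont; rewrite ?ger0_norm// (le_lt_trans yx).
Qed.

Let integrable_darcsinp_lt r x : 0 < r -> x < 1 ->
  lebesgue_measure.-integrable `[0, x] (EFin \o darcsinp r).
Proof.
move=> r0 x1; apply: continuous_compact_integrable; first exact: segment_compact.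
exact: within_continuous_darcsinp.
Qed.

Lemma is_derive_arcsinp r x : 0 < r -> 0 < x -> x < 1 ->
  is_derive x 1 (arcsinp r) (darcsinp r x).
Proof.
(* The midpoint of x and 1 keeps the interval of integration away from the singularity at 1. *)
move=> r0 x0 x1; have xm : x < (x + 1) / 2 by lra.
have m1 : (x + 1) / 2 < 1 by lra.
have [d dE] := continuous_FTC1_closed xm (integrable_darcsinp_lt r0 m1) x0
  (continuous_darcsinp r0 x0 x1).
apply: DeriveDef; first exact: d.
by rewrite -derive1E; exact: dE.
Qed.

Lemma arcsinp0 r : arcsinp r 0 = 0.
Proof. by rewrite /arcsinp set_itv1 Rintegral_set1. Qed.

Let arcsinp_within_lt r x : 0 < r -> 0 <= x -> x < 1 ->
  {within `[0, x], continuous (arcsinp r)}.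
Proof.
move=> r0 x0 x1.
exact: parameterized_integral_continuous (integrable_darcsinp_lt r0 x1).
Qed.

(** Since s^r <= s on [0, 1], the integrand is at most (1 - s)^(-1/r), whose primitive [G] is
    bounded because 1 - 1/r > 0. *)
Let arcsinp_le r x : 1 < r -> 0 <= x -> x < 1 ->
  arcsinp r x <= (1 - r^-1)^-1.
Proof.
move=> r1 x0 x1; have r0 : 0 < r by lra.
pose b := 1 - r^-1; have b0 : 0 < b by rewrite subr_gt0 invf_lt1.
pose G t : R := - b^-1 * (1 - t) `^ b.
have dG (t : R) : t < 1 -> is_derive t 1 G ((1 - t) `^ (- r^-1)).
  move=> t1; have t1' : 0 < 1 - t by lra.
  have := is_derive1Z (- b^-1) (@is_derive1_powR_comp R (fun t => 1 - t)
    t _ b t1' (is_derive1_cBid t 1)).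
  congr is_derive; rewrite mulrN1 mulrN mulNr opprK mulrA mulVf ?gt_eqF// mul1r.
  by congr (_ `^ _); rewrite /b; lra.
have : arcsinp r x - arcsinp r 0 <= G x - G 0.
  apply: (@is_derive1_le_le R _ _ (darcsinp r) (fun t => (1 - t) `^ (- r^-1))) => //.
  - move=> t; rewrite in_itv/= => /andP[t0 tx].
    by apply: is_derive_arcsinp => //; lra.
  - move=> t; rewrite in_itv/= => /andP[t0 tx].
    by apply: dG; lra.
  - exact: arcsinp_within_lt.
  - apply: is_derive1_within_continuous => t; rewrite in_itv/= => /andP[t0 tx].
    by apply: dG; lra.
  - move=> t; rewrite in_itv/= => /andP[t0 tx].
    rewrite /darcsinp !powRN lef_pV2 ?posrE ?powR_gt0 ?subr_gt0 ?powR_lt1//; try lra.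
    rewrite ge0_ler_powR ?invr_ge0 ?nnegrE ?subr_ge0 ?powR_le1//; try lra.
    by rewrite lerB// ge1r_powR// ?ltW//; lra.
rewrite arcsinp0 subr0 => /le_trans; apply.
rewrite /G subr0 powR1 mulr1 opprK gerDr mulNr oppr_le0.
by rewrite mulr_ge0 ?powR_ge0// invr_ge0 ltW.
Qed.

(** Monotone convergence along the segments [0, 1 - 1/(n+1)], on which [arcsinp_le] bounds the
    integrals uniformly. *)
Lemma integrable_darcsinp r : 1 < r ->
  lebesgue_measure.-integrable `[0, 1] (EFin \o darcsinp r).
Proof.
move=> r1; have r0 : 0 < r by lra.
have mf D : measurable_fun D (darcsinp r).
  apply: measurable_funTS.
  apply: (measurableT_comp (measurable_powR _)).
  by apply: measurable_funB => //; exact: measurable_powR.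
have mfE D : measurable_fun D (EFin \o darcsinp r) by exact/measurable_EFinP.
apply/integrableP; split; first exact: mfE.
under eq_integral do rewrite /= ger0_norm ?darcsinp_ge0//.
rewrite -(@integral_itv_bndo_bndc _ (BLeft 0) 1 (EFin \o darcsinp r))//.
pose F n : set (measurableTypeR R) := `[0, 1 - n.+1%:R^-1].
have -> : `[0, 1[ = \bigcup_n F n.
  apply/seteqP; split => x /=; rewrite in_itv/=; last first.
    move=> [n _]; rewrite /F/= in_itv/= => /andP[-> /=/le_lt_trans]; apply.
    by rewrite ltrBlDr ltrDl invr_gt0.
  move=> /andP[x0 x1]; have [n nx] := ltr_add_invr x1; exists n => //.
  by rewrite /F/= in_itv/= x0 lerBrDr ltW.
have ndF : nondecreasing_seq F.
  move=> m n mn; rewrite subsetEset; apply: subset_itvl.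
  by rewrite bnd_simp lerB// lef_pV2 ?posrE// ler_nat.
have mF i : measurable (F i) by exact: measurable_itv.
have F0 i x : F i x -> (0 <= (EFin \o darcsinp r) x)%E.
  by move=> _; rewrite lee_fin darcsinp_ge0.
have cv := ge0_nondecreasing_set_cvg_integral (mu := lebesgue_measure) ndF mF
  (fun i => mfE (F i)) F0.
apply: (@le_lt_trans _ _ ((1 - r^-1)^-1)%:E); last exact: ltry.
rewrite -(cvg_lim _ cv)//; apply: lime_le; first by apply/cvg_ex; eexists; exact: cv.
apply: nearW => n.
have n1 : 1 - n.+1%:R^-1 < 1 :> R by rewrite ltrBlDr ltrDl invr_gt0.
have n0 : 0 <= 1 - n.+1%:R^-1 :> R by rewrite subr_ge0 invf_le1// ler1n.
have := arcsinp_le r1 n0 n1; rewrite -lee_fin /arcsinp /Rintegral fineK//.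
exact: integrable_fin_num (integrable_darcsinp_lt r0 n1).
Qed.

Lemma within_continuous_arcsinp r : 1 < r ->
  {within `[0, 1], continuous (arcsinp r)}.
Proof.
by move=> r1; exact: parameterized_integral_continuous (integrable_darcsinp r1).
Qed.

Lemma arcsinp_lt r x y : 1 < r -> 0 <= x -> x < y -> y <= 1 ->
  arcsinp r x < arcsinp r y.
Proof.
move=> r1 x0 xy y1.
apply: (@is_derive1_gt0_lt R _ (darcsinp r)) => //.
- move=> t; rewrite in_itv/= => /andP[xt ty]; apply: is_derive_arcsinp; lra.
- apply: continuous_subspaceW (within_continuous_arcsinp r1).
  by apply: subset_itv; rewrite bnd_simp.
- move=> t; rewrite in_itv/= => /andP[xt ty]; apply: darcsinp_gt0; lra.
Qed.

End Arcsinp.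

(** * The reflection formula: the quarter period in closed form *)

Section Reflection.
Context {R : realType}.
Implicit Types (r x y c : R).
Local Open Scope classical_set_scope.

(** The geometric expansion of 1 / (1 + x^r), cut after N terms, leaves a remainder of size at most
    x^(rN). Integrated against x^(c-1), this gives an alternating series whose error is at most the
    size of the next term. *)
Lemma alternating_primitive_bound (f : R -> R) r c N : 0 < r -> 0 < c ->
  {within `[0, 1], continuous f} ->
  (forall x, x \in `]0, 1[%R -> is_derive x 1 f (x `^ (c - 1) / (1 + x `^ r))) ->
  `|f 1 - f 0 - \sum_(j < N) (-1) ^+ j / (j%:R * r + c)| <= (N%:R * r + c)^-1.
Proof.
move=> r0 c0 fc fd.
have jc (j : nat) : 0 < j%:R * r + c by rewrite ltr_wpDl// mulr_ge0// ltW.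
pose P (j : nat) (x : R) := (j%:R * r + c)^-1 * x `^ (j%:R * r + c).
have P0 j : P j 0 = 0 by rewrite /P powR0 ?mulr0// gt_eqF.
have P1 j : P j 1 = (j%:R * r + c)^-1 by rewrite /P powR1 mulr1.
have Pd j (x : R) : 0 < x ->
    is_derive x 1 (P j) ((x `^ r) ^+ j * x `^ (c - 1)).
  move=> x0; have := is_derive1Z (j%:R * r + c)^-1 (is_derive1_powR (j%:R * r + c) x0).
  congr is_derive; rewrite mulrA mulVf ?gt_eqF// mul1r.
  have -> : j%:R * r + c - 1 = r * j%:R + (c - 1) by ring.
  rewrite [LHS]powRD; last by rewrite (gt_eqF x0)/= implybT.
  by rewrite powRrM powR_mulrn ?powR_ge0.
have Pc j : {within `[0, 1], continuous (P j)}.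
  by apply: within_continuousMl; exact: within_continuous_powR.
pose g x := f x - \sum_(j < N) (-1) ^+ j * P j x.
have -> : f 1 - f 0 - \sum_(j < N) (-1) ^+ j / (j%:R * r + c) = g 1 - g 0.
  rewrite /g; under [X in _ = _ - _ - (_ - X)]eq_bigr do rewrite P0 mulr0.
  under [X in _ = _ - X - _]eq_bigr do rewrite P1.
  by rewrite [X in _ = _ - (_ - X)]big1// subr0 addrAC.
rewrite -(P1 N) -[P N 1]subr0 -[X in _ <= _ - X](P0 N).
apply: (@is_derive1_norm_le R g (P N)
  (fun x => x `^ (c - 1) / (1 + x `^ r) -
     \sum_(j < N) (-1) ^+ j * ((x `^ r) ^+ j * x `^ (c - 1)))
  (fun x => (x `^ r) ^+ N * x `^ (c - 1))) => //.
- move=> x x01; apply: is_derive1B; first exact: fd.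
  apply: is_derive1_sum => i; apply: is_derive1Z; apply: Pd.
  by move: x01; rewrite in_itv => /andP[].
- by move=> x; rewrite in_itv => /andP[x0 _]; exact: Pd.
- move=> x; apply: continuousB; first exact: fc.
  by apply: within_continuous_sum => i; exact: within_continuousMl.
- move=> x; rewrite in_itv/= => /andP[x0 x1].
  move: (powR_ge0 x (c - 1)) (powR_gt0 r x0) => u0 v0.
  move: (x `^ (c - 1)) (x `^ r) u0 v0 => u v u0 v0.
  have v1 : 0 < 1 + v by rewrite addr_gt0.
  have -> : \sum_(j < N) (-1) ^+ j * (v ^+ j * u) = u * (1 - (- v) ^+ N) / (1 + v).
    have -> : 1 - (- v) ^+ N = (1 + v) * \sum_(j < N) (- v) ^+ j.
      by rewrite -opprB subrX1 -mulNr opprB opprK.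
    rewrite mulrCA mulrAC mulfV ?gt_eqF// mul1r mulr_sumr.
    by apply: eq_bigr => j _; rewrite [in RHS]exprNn mulrA mulrC.
  have -> : u / (1 + v) - u * (1 - (- v) ^+ N) / (1 + v) = u * (- v) ^+ N / (1 + v).
    by field; rewrite gt_eqF.
  rewrite normrM normrM normrX normrN (ger0_norm u0) (gtr0_norm v0).
  rewrite normfV (gtr0_norm v1) ler_pdivrMr// [leLHS]mulrC.
  apply: ler_peMr; last by rewrite lerDl ltW.
  by rewrite mulr_ge0 ?exprn_ge0// ltW.
Qed.

(** A change of variable that removes the root splits the integral into two alternating series, in 1
    / (j r + 1) and 1 / (j r + r - 1), which together form the cosecant expansion at 1/r. *)
Lemma arcsinp1 r : 1 < r -> arcsinp r 1 = pip r / 2.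
Proof.
move=> r1; have r0 : 0 < r by lra.
have Ppos (x : R) : 0 < 1 + x `^ r by rewrite addrC ltr_wpDl ?powR_ge0.
pose k x := (1 + x `^ r) `^ (- r^-1).
have kpos x : 0 < k x by rewrite powR_gt0.
have kr (x : R) : k x `^ r = (1 + x `^ r)^-1.
  by rewrite -powRrM mulNr mulVf ?gt_eqF// powR_inv1 ?ltW.
have kV (x : R) : (1 + x `^ r)^-1 `^ (- r^-1) = (k x)^-1.
  by rewrite -(powR_inv1 (ltW (Ppos x))) -powRrM mulN1r opprK /k powRN invrK.
have kd (x : R) : 0 < x -> is_derive x 1 k (- (x `^ (r - 1) * k x / (1 + x `^ r))).
  move=> x0; have := @is_derive1_powR_comp R (fun x => 1 + x `^ r) x _ (- r^-1) (Ppos x)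
    (is_derive1D (is_derive_cst (1 : R) x (1 : R)) (is_derive1_powR r x0)).
  congr is_derive; rewrite add0r powRD; last by rewrite (gt_eqF (Ppos x)) implybT.
  rewrite powR_inv1 ?ltW// -/(k x); field.
  by rewrite !gt_eqF.
have kc : {within `[0, 1], continuous k}.
  apply: (@within_continuous_comp_sub _ _ `[1, 2] (fun x => 1 + x `^ r)
    (fun x => x `^ (- r^-1))).
  - apply: (within_continuousD (f := fun=> 1)); first exact: within_continuous_cst.
    exact: within_continuous_powR.
  - apply: (@is_derive1_within_continuous R _ (fun x => - r^-1 * x `^ (- r^-1 - 1))) => x.
    by rewrite in_itv/= => /andP[x1 _]; apply: is_derive1_powR; lra.
  - move=> x /=; rewrite !in_itv/= => x01.
    by have := powR_le1 r0 x01; have := powR_ge0 x r; lra.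
have k01 x : x \in `[0, 1]%R -> k x \in `[0, 1]%R.
  rewrite !in_itv/= => x01; rewrite ltW//= /k powRN invf_le1 ?powR_gt0//.
  rewrite -[leLHS](powRr0 (1 + x `^ r)); apply: ler_powR.
    by rewrite lerDl powR_ge0.
  by rewrite invr_ge0 ltW.
(* The substitution s = z * (1 + z ^ r) ^ (- 1 / r), which turns the integrand
   into 1 / (1 + z ^ r), maps [0, +oo[ onto [0, 1[; [G] is the part with z <= 1
   and [H], with z = 1 / x, the part with z >= 1. *)
pose G x := arcsinp r (x * k x).
pose H x := - arcsinp r (k x).
have Gc : {within `[0, 1], continuous G}.
  apply: (@within_continuous_comp_sub _ _ `[0, 1] (fun x => x * k x) (arcsinp r)).
  - by apply: (within_continuousM (f := fun x => x)) => //; exact: within_continuous_id.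
  - exact: within_continuous_arcsinp.
  - move=> x /= x01; have := k01 _ x01; move: x01; rewrite !in_itv/= => /andP[x0 x1] /andP[y0 y1].
    by rewrite mulr_ge0//= mulr_ile1.
have Hc : {within `[0, 1], continuous H}.
  apply: within_continuousN.
  apply: (@within_continuous_comp_sub _ _ `[0, 1] k (arcsinp r)) => //.
  exact: within_continuous_arcsinp.
have powr_inj x : 0 <= x -> x `^ r < 1 -> x < 1.
  by move=> x0; apply: contraTT; rewrite -!leNgt => x1; rewrite -(powRr0 x) ler_powR// ltW.
have Gd (x : R) : x \in `]0, 1[%R -> is_derive x 1 G (x `^ (1 - 1) / (1 + x `^ r)).
  rewrite in_itv/= => /andP[x0 x1].
  have xr0 := powR_gt0 r x0.
  have e : (x * k x) `^ r = x `^ r / (1 + x `^ r) by rewrite powRM ?ltW// kr.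
  have xk0 : 0 < x * k x by rewrite mulr_gt0.
  have xk1 : x * k x < 1.
    by apply: powr_inj; rewrite ?ltW// e ltr_pdivrMr//; lra.
  have := @is_derive1_composite R (arcsinp r) (fun x => x * k x) x _ _
    (is_derive_arcsinp r0 xk0 xk1)
    (is_derive1M (is_derive_id x (1 : R)) (kd _ x0)).
  congr is_derive; rewrite subrr powRr0.
  rewrite /darcsinp e.
  have -> : 1 - x `^ r / (1 + x `^ r) = (1 + x `^ r)^-1 by field; rewrite gt_eqF.
  rewrite kV -(mulr_powRB1 (ltW x0) r0).
  have := Ppos x; rewrite -(mulr_powRB1 (ltW x0) r0) => P0.
  by field; rewrite !gt_eqF.
have Hd (x : R) : x \in `]0, 1[%R -> is_derive x 1 H (x `^ (r - 1 - 1) / (1 + x `^ r)).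
  rewrite in_itv/= => /andP[x0 x1].
  have xr0 := powR_gt0 r x0.
  have k1 : k x < 1.
    by apply: powr_inj; rewrite ?ltW// kr invf_lt1//; lra.
  have := is_deriveN (@is_derive1_composite R (arcsinp r) k x _ _
    (is_derive_arcsinp r0 (kpos x) k1) (kd _ x0)).
  congr is_derive.
  rewrite /darcsinp kr.
  have -> : 1 - (1 + x `^ r)^-1 = x `^ r / (1 + x `^ r) by field; rewrite gt_eqF.
  have xV : x `^ r `^ (- r^-1) = x^-1.
    by rewrite -powRrM mulrN mulfV ?gt_eqF// powR_inv1 ?ltW.
  rewrite powRM ?powR_ge0 ?invr_ge0 ?ltW// kV xV.
  have -> : x `^ (r - 1 - 1) = x `^ (r - 1) / x.
    by rewrite [LHS]powRB ?powRr1 ?ltW// (gt_eqF x0) implybT.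
  by field; rewrite !gt_eqF.
have k0 : k 0 = 1 by rewrite /k powR0 ?gt_eqF// addr0 powR1.
(* The increments of [G] and [H] over [0, 1] are [arcsinp r (k 1)] and
   [arcsinp r 1 - arcsinp r (k 1)], which add up to [arcsinp r 1]. *)
have bound N : `|arcsinp r 1 - r^-1 * csc_partial r^-1 N| <=
    (N.+1%:R * r + 1)^-1 + (N%:R * r + (r - 1))^-1.
  have c0 : 0 < r - 1 by lra.
  have := lerD (alternating_primitive_bound N.+1 r0 ltr01 Gc Gd)
    (alternating_primitive_bound N r0 c0 Hc Hd).
  apply: le_trans; apply: le_trans (ler_normD _ _).
  rewrite /G /H mul0r arcsinp0 mul1r k0.
  (* The central term and the N terms of positive index give the series with c = 1, hence [N.+1]
     terms; the negative indices give the N terms with c = r - 1. *)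
  have -> : r^-1 * csc_partial r^-1 N =
     \sum_(j < N.+1) (-1) ^+ j / (j%:R * r + 1) +
     \sum_(j < N) (-1) ^+ j / (j%:R * r + (r - 1)).
    rewrite big_ord_recl/= mul0r add0r expr0 divr1 -addrA -big_split/=.
    rewrite /csc_partial mulrDr invrK mulVf ?gt_eqF//; congr (_ + _).
    rewrite mulr_sumr; apply: eq_bigr => i _.
    rewrite /bump/= add1n !exprS.
    have i0 : 0 <= i%:R :> R by [].
    rewrite -natr1.
    have h1 : i%:R * r + r - 1 != 0.
      by rewrite gt_eqF// -addrA ltr_wpDl// mulr_ge0// ltW.
    have h2 : i%:R * r + r + 1 != 0.
      by rewrite gt_eqF// ltr_wpDl// addr_ge0// ?mulr_ge0// ltW.
    field.
    rewrite (gt_eqF r0)/=; apply/and3P; split; apply/eqP.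
    - by move: h1 => /eqP h1; lra.
    - by move: h2 => /eqP h2; lra.
    - by move: h1 => /eqP h1; lra.
  rewrite le_eqVlt; apply/orP; left; apply/eqP; congr (`|_|).
  ring.
(* The bound also provides the convergence that [csc_partial_lim] presupposes. *)
have csc_cvg : csc_partial r^-1 @ \oo --> r * arcsinp r 1.
  apply/cvgrPdist_le => e e0; near=> N.
  have -> : r * arcsinp r 1 - csc_partial r^-1 N =
     r * (arcsinp r 1 - r^-1 * csc_partial r^-1 N) by field; rewrite gt_eqF.
  have N0 : 0 < N%:R :> R by rewrite ltr0n; near: N; exists 1%N.
  rewrite normrM (gtr0_norm r0) -ler_pdivlMl//.
  apply: le_trans (bound N) _.
  apply: (@le_trans _ _ (N%:R^-1 + N%:R^-1)).
    apply: lerD; rewrite lef_pV2 ?posrE//.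
    - by rewrite -natr1; nra.
    - by rewrite -natr1; nra.
    - by nra.
    - by nra.
  have NE : 2 * r / e <= N%:R by near: N; exact: nbhs_infty_ger.
  rewrite -mulr2n -[_ *+ 2]mulr_natl ler_pdivrMr// -ler_pdivrMl ?mulr_gt0 ?invr_gt0//.
  apply: le_trans NE; rewrite le_eqVlt; apply/orP; left; apply/eqP.
  by field; rewrite !gt_eqF.
have rV0 : 0 < r^-1 by rewrite invr_gt0.
have rV1 : r^-1 < 1 by rewrite invf_lt1.
have e := csc_partial_lim rV0 rV1 csc_cvg.
have s0 : 0 < sin (pi / r).
  apply: sin_gt0_pi; rewrite divr_gt0 ?pi_gt0//= ltr_pdivrMr// ltr_pMr ?pi_gt0//.
rewrite /pip -{1}e [r^-1 * pi]mulrC.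
by field; rewrite !gt_eqF.
Unshelve. all: by end_near. Qed.

End Reflection.

(** * The generalized sine on its first quarter period *)

Section Sinp.
Context {R : realType}.
Implicit Types (r x y : R).
Local Open Scope classical_set_scope.

Lemma sin_pi_div_gt0 r : 1 < r -> 0 < sin (pi / r).
Proof.
move=> r1; have r0 : 0 < r by lra.
by apply: sin_gt0_pi; rewrite divr_gt0 ?pi_gt0//= ltr_pdivrMr// ltr_pMr ?pi_gt0.
Qed.

Lemma pip_gt0 r : 1 < r -> 0 < pip r.
Proof.
move=> r1; rewrite divr_gt0 ?mulr_gt0 ?pi_gt0 ?sin_pi_div_gt0//; lra.
Qed.

Lemma sinp_quarterK r x : 1 < r -> 0 <= x <= 1 ->
  sinp_quarter r (arcsinp r x) = x.
Proof.
move=> r1 x01; apply: pinvKV; last by rewrite inE.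
move=> a b; rewrite !inE/= !in_itv/= => /andP[a0 a1] /andP[b0 b1] ab.
have [lt_ab|lt_ba|//] := ltgtP a b.
  by have := arcsinp_lt r1 a0 lt_ab b1; rewrite ab ltxx.
by have := arcsinp_lt r1 b0 lt_ba a1; rewrite ab ltxx.
Qed.

Lemma sinp_quarter0 r : 1 < r -> sinp_quarter r 0 = 0.
Proof. by move=> r1; rewrite -[in LHS](arcsinp0 r) sinp_quarterK// lexx ler01. Qed.

Lemma sinp_quarter_pip r : 1 < r -> sinp_quarter r (pip r / 2) = 1.
Proof. by move=> r1; rewrite -arcsinp1// sinp_quarterK// lexx ler01. Qed.

Lemma arcsinp_surj r y : 1 < r -> 0 <= y <= pip r / 2 ->
  exists2 x, 0 <= x <= 1 & arcsinp r x = y.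
Proof.
move=> r1 /andP[y0 y1].
have [|x] := @IVT R (arcsinp r) 0 1 y ler01 (within_continuous_arcsinp r1).
  rewrite arcsinp0 arcsinp1// min_l ?max_r ?y0//; exact: le_trans y1.
by rewrite in_itv/= => x01 xy; exists x.
Qed.

Lemma within_continuous_sinp_quarter r : 1 < r ->
  {within `[0, pip r / 2], continuous (sinp_quarter r)}.
Proof.
move=> r1; rewrite -arcsinp1// -(arcsinp0 r).
apply: segment_can_le_continuous ler01 (within_continuous_arcsinp r1) _.
by move=> x; rewrite in_itv/=; exact: sinp_quarterK.
Qed.

Lemma sinp_quarter_bounds r y : 1 < r -> 0 <= y <= pip r / 2 ->
  0 <= sinp_quarter r y <= 1.
Proof. by move=> r1 /(arcsinp_surj r1)[x x01 <-]; rewrite sinp_quarterK. Qed.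

Lemma sinp_quarter_in r y : 1 < r -> 0 < y < pip r / 2 ->
  0 < sinp_quarter r y < 1.
Proof.
move=> r1 /andP[y0 y1]; have y01 : 0 <= y <= pip r / 2 by rewrite !ltW.
have [x /andP[x0 x1] xy] := arcsinp_surj r1 y01.
rewrite -xy sinp_quarterK ?x0// !lt_neqAle x0 x1 !andbT.
apply/andP; split; apply/eqP => x_eq; move: y0 y1; rewrite -xy.
  by rewrite -x_eq arcsinp0 ltxx.
by rewrite x_eq arcsinp1// ltxx.
Qed.

(** The inverse function rule. The formula is the generalized Pythagorean identity: the r-th powers
    of the function and of its derivative add up to 1. *)
Lemma is_derive_sinp_quarter r y : 1 < r -> 0 < y < pip r / 2 ->
  is_derive y 1 (sinp_quarter r) ((1 - sinp_quarter r y `^ r) `^ r^-1).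
Proof.
move=> r1 y01; have r0 : 0 < r by lra.
have [x0 x1] := andP (sinp_quarter_in r1 y01).
have [x x01 xy] : exists2 x, 0 <= x <= 1 & arcsinp r x = y.
  by apply: arcsinp_surj => //; case/andP: y01 => ? ?; rewrite !ltW.
move: x0 x1; rewrite -xy sinp_quarterK// => x0 x1.
have -> : (1 - x `^ r) `^ r^-1 = (darcsinp r x)^-1.
  by rewrite /darcsinp powRN invrK.
have nx : \forall t \near x, t \in `]0, 1[%R.
  by apply: near_in_itvoo; rewrite in_itv/= x0.
apply: (@is_derive_inverse _ (arcsinp r)).
- near=> t; apply: sinp_quarterK => //.
  have : t \in `]0, 1[%R by near: t.
  by rewrite in_itv/= => /andP[? ?]; rewrite !ltW.
- near=> t; have : t \in `]0, 1[%R by near: t.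
  rewrite in_itv/= => /andP[? ?].
  by apply: is_derive1_continuous (is_derive_arcsinp _ _ _).
- exact: is_derive_arcsinp.
- by rewrite gt_eqF// darcsinp_gt0// ltW.
Unshelve. all: by end_near. Qed.

End Sinp.

(** * Elementary inequalities *)

Section Ineq.
Context {R : realType}.
(** The function t^q - q t has a strict minimum at t = 1, where its derivative changes sign. *)
Lemma bernoulli_powR_lt (q x : R) : 1 < q -> 0 < x -> x != 1 ->
  1 + q * (x - 1) < x `^ q.
Proof.
move=> q1 x0 x_neq.
pose k (t : R) := t `^ q - q * t.
have kd (t : R) : 0 < t -> is_derive t 1 k (q * t `^ (q - 1) - q).
  move=> t0; apply: (@is_derive1B R (fun t => t `^ q) ( *%R q)).
    exact: is_derive1_powR.
  exact: is_derive1_scale.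
have kc a b : 0 < a -> {within `[a, b], continuous k}%classic.
  move=> a0; apply: (@is_derive1_within_continuous R _ (fun t => q * t `^ (q - 1) - q)) => t.
  by rewrite in_itv/= => /andP[at_ _]; apply: kd; exact: lt_le_trans at_.
suff : k 1 < k x by rewrite /k powR1; lra.
have [x1|x1|] := ltgtP x 1; last by move/eqP; rewrite (negbTE x_neq).
  suff : - k x < - k 1 by rewrite ltrN2.
  apply: (@is_derive1_gt0_lt R (fun t => - k t) (fun t => - (q * t `^ (q - 1) - q))) => //.
  - move=> t; rewrite in_itv/= => /andP[t0 t1]; apply: is_deriveN; apply: kd; lra.
  - by move=> t; apply: continuousN; exact: kc.
  - move=> t; rewrite in_itv/= => /andP[t0 t1]; rewrite oppr_gt0 subr_lt0.
    rewrite -[ltRHS]mulr1 ltr_pM2l; last lra.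
    have := @gt0_ltr_powR R (q - 1) _ t 1; rewrite powR1; apply; rewrite ?nnegrE; lra.
apply: (@is_derive1_gt0_lt R k (fun t => (q * t `^ (q - 1) - q))) => //.
- move=> t; rewrite in_itv/= => /andP[t0 t1]; apply: kd; lra.
- exact: kc.
- move=> t; rewrite in_itv/= => /andP[t0 t1]; rewrite subr_gt0.
  rewrite -[ltLHS]mulr1 ltr_pM2l; last lra.
  have := @gt0_ltr_powR R (q - 1) _ 1 t; rewrite powR1; apply; rewrite ?nnegrE; lra.
Qed.

(* The tangent line of [t `^ q] at [z], scaled to be homogeneous. *)
Lemma powR_tangent_lt (q y z : R) : 1 < q -> 0 < y -> 0 < z -> y != z ->
  q * z `^ (q - 1) * y < y `^ q + (q - 1) * z `^ q.
Proof.
move=> q1 y0 z0 yz.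
have := bernoulli_powR_lt q1 (divr_gt0 y0 z0).
have yz1 : y / z != 1.
  by apply: contra yz => /eqP e; rewrite -(divfK (lt0r_neq0 z0) y) e mul1r.
move=> /(_ yz1).
have zq := powR_gt0 q z0.
have -> : (y / z) `^ q = y `^ q / z `^ q.
  rewrite powRM ?invr_ge0 ?ltW//; congr (_ * _).
  by rewrite -(powR_inv1 (ltW z0)) powRAC powR_inv1 ?powR_ge0.
rewrite ltr_pdivlMr//.
rewrite -(@mulr_powRB1 R z q) ?(ltW z0) //; last lra.
have -> : (1 + q * (y / z - 1)) * (z * z `^ (q - 1)) =
  z * z `^ (q - 1) * (1 - q) + q * z `^ (q - 1) * y by field; rewrite gt_eqF.
lra.
Qed.

(** The derivative of t / sin t has numerator sin t - t cos t, which vanishes at 0 and has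
    derivative t sin t > 0. *)
Lemma ltr_x_div_sin (x y : R) : 0 < x -> x < y -> y < pi -> x / sin x < y / sin y.
Proof.
move=> x0 xy ypi.
have sx : 0 < sin x by apply: sin_gt0_pi; lra.
have sy : 0 < sin y by apply: sin_gt0_pi; lra.
have aux (t : R) : 0 < t -> t < pi -> 0 < sin t - t * cos t.
  move=> t0 tpi.
  have : (fun t => sin t - t * cos t) 0 < (fun t => sin t - t * cos t) t.
    have d (u : R) : is_derive u 1 (fun t => sin t - t * cos t) (u * sin u).
      have := is_derive1B (is_derive_sin u)
         (is_derive1M (is_derive_id u (1 : R)) (is_derive_cos u)).
      by congr is_derive; ring.
    apply: (@is_derive1_gt0_lt R _ (fun u => u * sin u)) => //.
    - by apply: is_derive1_within_continuous => u _; exact: d.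
    - move=> u; rewrite in_itv/= => /andP[u0 ut]; rewrite mulr_gt0//.
      by apply: sin_gt0_pi; lra.
  by rewrite /= sin0 mul0r subr0.
apply: (@is_derive1_gt0_lt R (fun t => t / sin t)
  (fun t => (sin t - t * cos t) / sin t ^+ 2)) => //.
- move=> t; rewrite in_itv/= => /andP[xt ty].
  have st : 0 < sin t by apply: sin_gt0_pi; lra.
  have := is_derive1M (is_derive_id t (1 : R))
    (is_deriveV (lt0r_neq0 st) (is_derive_sin t)).
  congr is_derive; rewrite /GRing.scale/=; field; exact: lt0r_neq0.
- apply: (@is_derive1_within_continuous R _ (fun t => (sin t - t * cos t) / sin t ^+ 2)) => t.
  rewrite in_itv/= => /andP[xt ty].
  have st : 0 < sin t by apply: sin_gt0_pi; lra.
  have := is_derive1M (is_derive_id t (1 : R))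
    (is_deriveV (lt0r_neq0 st) (is_derive_sin t)).
  congr is_derive; rewrite /GRing.scale/=; field; exact: lt0r_neq0.
- move=> t; rewrite in_itv/= => /andP[xt ty].
  rewrite divr_gt0 ?exprn_gt0//; first by apply: aux; lra.
  by apply: sin_gt0_pi; lra.
Qed.

Lemma sin_le_id (x : R) : 0 <= x -> sin x <= x.
Proof.
move=> x0.
have := @is_derive1_le_le R sin (fun t => t) cos (fun=> 1) 0 x x0.
rewrite sin0 !subr0; apply.
- by apply: is_derive1_within_continuous => t _; exact: is_derive_sin.
- by apply: continuous_subspaceT => t; exact: cvg_id.
- by move=> t _; exact: cos_le1.
Qed.

End Ineq.

(** * The increasing half of the eigenfunctions *)

Section HalfArch.
Context {R : realType}.
Implicit Types (r t : R).
Local Open Scope classical_set_scope.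

Variables (r c L : R).
Hypotheses (r_gt1 : 1 < r) (L_gt0 : 0 < L) (c_gt0 : 0 < c)
  (cL : c * L = pip r / 2).

(* For c = pip r / T, [arch r c] is [phi T r] on its increasing half [0, T / 2]
   and [darch r c] is the derivative of [arch r c]. *)
Definition arch r c t : R := sinp_quarter r (c * t).
Definition darch r c t : R := c * (1 - arch r c t `^ r) `^ r^-1.

Let r_gt0 : 0 < r. Proof. exact: lt_trans ltr01 r_gt1. Qed.

Let ct_bounds t : 0 <= t <= L -> 0 <= c * t <= pip r / 2.
Proof. by move=> /andP[t0 tL]; rewrite -cL mulr_ge0 ?(ltW c_gt0)//= ler_pM2l. Qed.

Let ct_in t : 0 < t < L -> 0 < c * t < pip r / 2.
Proof. by move=> /andP[t0 tL]; rewrite -cL mulr_gt0//= ltr_pM2l. Qed.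

Lemma arch0 : arch r c 0 = 0.
Proof. by rewrite /arch mulr0 sinp_quarter0. Qed.

Lemma archL : arch r c L = 1.
Proof. by rewrite /arch cL sinp_quarter_pip. Qed.

Lemma arch_bounds t : 0 <= t <= L -> 0 <= arch r c t <= 1.
Proof. by move=> /ct_bounds; exact: sinp_quarter_bounds. Qed.

Lemma arch_in t : 0 < t < L -> 0 < arch r c t < 1.
Proof. by move=> /ct_in; exact: sinp_quarter_in. Qed.

Lemma within_continuous_arch : {within `[0, L], continuous (arch r c)}.
Proof.
apply: (@within_continuous_comp_sub _ _ `[0, pip r / 2] ( *%R c)).
- by apply: within_continuousMl; exact: within_continuous_id.
- exact: within_continuous_sinp_quarter.
- by move=> t /=; rewrite !in_itv/=; exact: ct_bounds.
Qed.

Lemma is_derive_arch t : 0 < t < L -> is_derive t 1 (arch r c) (darch r c t).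
Proof.
move=> /ct_in t01; rewrite /darch mulrC.
exact: is_derive1_composite (is_derive_sinp_quarter r_gt1 t01) (is_derive1_scale t c).
Qed.

Lemma within_continuous_darch : {within `[0, L], continuous (darch r c)}.
Proof.
apply: within_continuousMl.
apply: (@within_continuous_comp_sub _ _ `[0, 1] (fun t => 1 - arch r c t `^ r)
  (fun x => x `^ r^-1)).
- apply: (within_continuousD (f := fun=> 1)); first exact: within_continuous_cst.
  apply: within_continuousN.
  apply: (@within_continuous_comp_sub _ _ `[0, 1] (arch r c) (fun x => x `^ r)).
  + exact: within_continuous_arch.
  + exact: within_continuous_powR.
  + by move=> t /=; rewrite !in_itv/=; exact: arch_bounds.
- by apply: within_continuous_powR => //; rewrite invr_gt0.
- move=> t /=; rewrite !in_itv/= => /arch_bounds/(powR_le1 r_gt0) h.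
  by rewrite subr_ge0 h gerBl powR_ge0.
Qed.

Lemma darch0 : darch r c 0 = c.
Proof. by rewrite /darch arch0 powR0 ?gt_eqF// subr0 powR1 mulr1. Qed.

Lemma darch_in t : 0 < t < L -> 0 < darch r c t < c.
Proof.
move=> /arch_in/andP[u0 u1]; rewrite mulr_gt0 ?powR_gt0 ?subr_gt0 ?powR_lt1 ?ltW//=.
rewrite -[ltRHS]mulr1 ltr_pM2l// powR_lt1 ?invr_gt0// ?subr_ge0.
  by rewrite powR_le1// !ltW.
by rewrite gtrBl powR_gt0.
Qed.

Lemma arch_le t : 0 <= t <= L -> arch r c t <= c * t.
Proof.
move=> /andP[t0 tL].
have := @is_derive1_le_le R (arch r c) ( *%R c) (darch r c) (fun=> c) 0 t t0.
rewrite arch0 mulr0 !subr0; apply.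
- move=> s; rewrite in_itv/= => /andP[s0 st]; apply: is_derive_arch.
  by rewrite s0 (lt_le_trans st).
- by move=> s _; exact: is_derive1_scale.
- apply: continuous_subspaceW within_continuous_arch.
  by apply: subset_itvl; rewrite bnd_simp.
- by apply: within_continuousMl; exact: within_continuous_id.
- move=> s; rewrite in_itv/= => /andP[s0 st].
  have sL : 0 < s < L by rewrite s0 (lt_le_trans st).
  by have /andP[_ /ltW] := darch_in sL.
Qed.

Let arch_lt s t : 0 <= s -> s < t -> t <= L -> arch r c s < arch r c t.
Proof.
move=> s0 st tL.
apply: (@is_derive1_gt0_lt R _ (darch r c)) => //.
- move=> x; rewrite in_itv/= => /andP[sx xt]; apply: is_derive_arch; lra.
- apply: continuous_subspaceW within_continuous_arch.
  by apply: subset_itv; rewrite bnd_simp.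
- move=> x; rewrite in_itv/= => /andP[sx xt].
  have xL : 0 < x < L by lra.
  by have /andP[] := darch_in xL.
Qed.

(* By concavity: the slope [darch r c] decreases. *)
Lemma arch_ge t : 0 <= t <= L -> t / L <= arch r c t.
Proof.
move=> /andP[]; rewrite le_eqVlt => /predU1P[<- _|t0]; first by rewrite arch0 mul0r.
rewrite le_eqVlt => /predU1P[->|tL]; first by rewrite archL divff ?gt_eqF.
have sub a b : 0 <= a -> b <= L -> {within `[a, b], continuous (arch r c)}.
  move=> a0 bL; apply: continuous_subspaceW within_continuous_arch.
  by apply: subset_itv; rewrite bnd_simp.
have d a b x : 0 <= a -> b <= L -> x \in `]a, b[%R -> is_derive x 1 (arch r c) (darch r c x).
  rewrite in_itv/= => a0 bL /andP[ax xb]; apply: is_derive_arch.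
  by rewrite (le_lt_trans a0)// (lt_le_trans xb).
have [x + ex] := MVT t0 (fun x => d 0 t x (lexx _) (ltW tL)) (sub 0 t (lexx _) (ltW tL)).
have [y + ey] := MVT tL (fun x => d t L x (ltW t0) (lexx _)) (sub t L (ltW t0) (lexx _)).
rewrite !in_itv/= => /andP[ty yL] /andP[x0 xt].
move: ex ey; rewrite archL arch0 !subr0 => ex ey.
(* Below the chord from (0, 0) to (L, 1), the mean slope would be less than 1/L on [0, t] and more
   than 1/L on [t, L], whereas [darch] is smaller at y than at x. *)
rewrite leNgt; apply/negP => lt_chord.
have x0L : 0 < x < L by rewrite x0 (lt_trans xt).
have y0L : 0 < y < L by rewrite yL (lt_trans t0).
have xy : arch r c x < arch r c y.
  by apply: arch_lt; [exact: ltW|exact: lt_trans ty|exact: ltW].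
have /andP[ux0 ux1] := arch_in x0L.
have /andP[uy0 uy1] := arch_in y0L.
have slope : darch r c y < darch r c x.
  rewrite /darch ltr_pM2l// gt0_ltr_powR ?nnegrE ?invr_gt0 ?subr_ge0//.
  - by rewrite powR_le1// !ltW.
  - by rewrite powR_le1// !ltW.
  - by rewrite ltrD2l ltrN2 gt0_ltr_powR ?nnegrE// ltW.
move: lt_chord; rewrite ex ltr_pdivlMr// => h1.
have h2 : darch r c x * L < 1.
  by move: h1; rewrite mulrAC -{2}[t]mul1r ltr_pM2r.
have Lt : 0 < L - t by rewrite subr_gt0.
move: ex ey h2 slope Lt; clear.
move: (darch r c x) (darch r c y) (arch r c t) => a b u -> e h ba Lt.
have : b * (L - t) < a * (L - t) by rewrite ltr_pM2r.
by rewrite -e; lra.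
Qed.

End HalfArch.

(** * Bounds for the Rayleigh quotient *)

Section Rayleigh.
Context {R : realType}.
Local Open Scope classical_set_scope.
Notation mu := (@lebesgue_measure R).

(** * Bounds on the two integrals for the upper estimate *)

Section Bounds.
Variables (p q c L : R).
Hypotheses (p_gt1 : 1 < p) (q_gt1 : 1 < q) (L_gt0 : 0 < L) (c_gt0 : 0 < c)
  (cL : c * L = pip p / 2).

Let q_gt0 : 0 < q. Proof. exact: lt_trans ltr01 q_gt1. Qed.

Lemma within_continuous_arch_powR :
  {within `[0, L], continuous (fun t => arch p c t `^ q)}.
Proof.
apply: (@within_continuous_comp_sub _ _ `[0, 1] (arch p c) (fun x => x `^ q)).
- exact: within_continuous_arch.
- exact: within_continuous_powR.
- by move=> t /=; rewrite !in_itv/=; exact: arch_bounds.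
Qed.

Lemma within_continuous_darch_powR :
  {within `[0, L], continuous (fun t => darch p c t `^ q)}.
Proof.
apply: (@within_continuous_comp_sub _ _ `[0, c] (darch p c) (fun x => x `^ q)).
- exact: within_continuous_darch.
- exact: within_continuous_powR.
- move=> t /=; rewrite !in_itv/= => /(arch_bounds p_gt1 c_gt0 cL) h.
  rewrite /darch mulr_ge0 ?powR_ge0 ?(ltW c_gt0)//= ler_piMr ?(ltW c_gt0)//.
  have p_gt0 := lt_trans ltr01 p_gt1.
  have hp := powR_le1 p_gt0 h.
  by rewrite powR_le1 ?invr_gt0// subr_ge0 hp gerBl powR_ge0.
Qed.

(** As 0 < [darch p c t] < c, the integrand is less than c^(q-1) times [darch p c t], which has the
    primitive [arch p c] with total increment 1. *)
Lemma integral_darch_lt : \int[mu]_(t in `[0, L]) (darch p c t `^ q) < c `^ (q - 1).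
Proof.
pose X x := \int[mu]_(t in `[0, x]) (darch p c t `^ q).
have [X0 Xc Xd] : [/\ X 0 = 0, {within `[0, L], continuous X} &
    forall x, x \in `]0, L[%R -> is_derive x 1 X (darch p c x `^ q)] :=
  primitive_spec L_gt0 within_continuous_darch_powR.
pose Z x := c `^ (q - 1) * arch p c x - X x.
have Zd x : x \in `]0, L[%R ->
    is_derive x 1 Z (c `^ (q - 1) * darch p c x - darch p c x `^ q).
  move=> xL; apply: is_derive1B; last exact: Xd.
  apply: is_derive1Z; apply: (is_derive_arch p_gt1 c_gt0 cL).
  by move: xL; rewrite in_itv.
have : Z 0 < Z L.
  apply: (is_derive1_gt0_lt L_gt0 Zd).
  - apply: within_continuousD; last exact: within_continuousN Xc.
    exact: within_continuousMl (within_continuous_arch p_gt1 c_gt0 cL).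
  - move=> x; rewrite in_itv/= => xL; have /andP[d0 dc] := darch_in p_gt1 c_gt0 cL xL.
    rewrite subr_gt0 -(mulr_powRB1 (ltW d0) q_gt0) mulrC ltr_pM2r//.
    by rewrite gt0_ltr_powR ?nnegrE ?subr_gt0// ltW.
by rewrite /Z X0 (arch0 _ p_gt1) (archL p_gt1 cL) mulr0 mulr1 subr0 subr_gt0.
Qed.

(** By [arch_ge] the integrand is at least (t / L)^q, whose primitive is [Q]. *)
Lemma integral_arch_ge : L / (q + 1) <= \int[mu]_(t in `[0, L]) (arch p c t `^ q).
Proof.
pose X x := \int[mu]_(t in `[0, x]) (arch p c t `^ q).
have [X0 Xc Xd] : [/\ X 0 = 0, {within `[0, L], continuous X} &
    forall x, x \in `]0, L[%R -> is_derive x 1 X (arch p c x `^ q)] :=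
  primitive_spec L_gt0 within_continuous_arch_powR.
have q1_gt0 : 0 < q + 1 by rewrite addr_gt0.
pose Q (t : R) := (L `^ q * (q + 1))^-1 * t `^ (q + 1).
have Q0 : Q 0 = 0 by rewrite /Q powR0 ?mulr0// gt_eqF.
have QL : Q L = L / (q + 1).
  rewrite /Q powRD ?(gt_eqF q1_gt0)//= powRr1 ?ltW//; field.
  by rewrite !gt_eqF// powR_gt0.
rewrite -QL -[leLHS]subr0 -[X in _ - X]Q0 -[leRHS]subr0 -[X in _ <= _ - X]X0.
apply: (@is_derive1_le_le R Q X (fun t => (t / L) `^ q) (fun t => arch p c t `^ q)) => //.
- exact: ltW.
- move=> t; rewrite in_itv/= => /andP[t0 _].
  have := is_derive1Z (L `^ q * (q + 1))^-1 (is_derive1_powR (q + 1) t0).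
  congr is_derive; rewrite addrK powRM ?invr_ge0 ?ltW//.
  have -> : L^-1 `^ q = (L `^ q)^-1.
    by rewrite -(powR_inv1 (ltW L_gt0)) powRAC powR_inv1 ?powR_ge0.
  by field; rewrite !gt_eqF// powR_gt0.
- by apply: within_continuousMl; exact: within_continuous_powR.
- move=> t; rewrite in_itv/= => /andP[t0 tL].
  have tL' : 0 <= t <= L by rewrite !ltW.
  rewrite ge0_ler_powR ?nnegrE ?divr_ge0 ?(ltW q_gt0) ?(ltW t0) ?(ltW L_gt0)//.
    by have /andP[] := arch_bounds p_gt1 c_gt0 cL tL'.
  exact: arch_ge p_gt1 L_gt0 c_gt0 cL _ tL'.
Qed.

End Bounds.

(** * The lower bound by Picone's identity *)

Section Picone.
Variables (p q a b L : R).
Hypotheses (p_gt1 : 1 < p) (q_gt1 : 1 < q) (L_gt0 : 0 < L) (a_gt0 : 0 < a)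
  (ab : a < b) (aL : a * L = pip p / 2) (bL : b * L = pip q / 2).

Let q_gt0 : 0 < q. Proof. exact: lt_trans ltr01 q_gt1. Qed.
Let b_gt0 : 0 < b. Proof. exact: lt_trans a_gt0 ab. Qed.

Let u := arch p a.
Let v := arch q b.
Let du := darch p a.
Let dv := darch q b.

(* [riccati] is the (q - 1)-st power of the logarithmic derivative [dv / v] of
   the q-eigenfunction. *)
Let w t := v t `^ (- q) - 1.
(** The logarithmic derivative [dv / v] in closed form, since [w] is (1 - v^q) / v^q. *)
Let m t := b * w t `^ q^-1.
Let riccati t := b `^ (q - 1) * w t `^ ((q - 1) / q).

Let w_gt0 t : 0 < t < L -> 0 < w t.
Proof.
move=> tL; have /andP[v0 v1] := arch_in q_gt1 b_gt0 bL tL.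
rewrite subr_gt0 powRN invf_gt1 ?powR_gt0//.
by rewrite powR_lt1// ltW.
Qed.

Let dvE t : 0 < t < L -> dv t = v t * m t.
Proof.
move=> tL; have /andP[v0 v1] := arch_in q_gt1 b_gt0 bL tL.
rewrite /dv /darch -/v /m mulrCA; congr (_ * _).
have -> : 1 - v t `^ q = v t `^ q * w t.
  by rewrite /w powRN mulrBr mulr1 mulfV// gt_eqF// powR_gt0.
by rewrite powRM ?powR_ge0 ?(ltW (w_gt0 tL))// -powRrM mulfV ?gt_eqF// powRr1 ?ltW.
Qed.

Let riccatiE t : 0 < t < L -> riccati t = m t `^ (q - 1).
Proof.
move=> tL; rewrite /m powRM ?(ltW b_gt0) ?powR_ge0// -powRrM [q^-1 * _]mulrC.
by [].
Qed.

Let m_gt0 t : 0 < t < L -> 0 < m t.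
Proof. by move=> tL; rewrite mulr_gt0// powR_gt0// w_gt0. Qed.

Let mq t : 0 < t < L -> m t `^ q = b `^ q * w t.
Proof.
move=> tL; rewrite /m powRM ?(ltW b_gt0) ?powR_ge0// -powRrM mulVf ?gt_eqF//.
by rewrite powRr1// ltW// w_gt0.
Qed.

(** The Riccati equation: as v^(-q) = 1 + w, the derivative is also -(q - 1) b^q - (q - 1) m^q, and
    its constant part cancels the eigenvalue term in [H]. *)
Let is_derive_riccati t : 0 < t < L ->
  is_derive t 1 riccati (- (b `^ q * (q - 1) * v t `^ (- q))).
Proof.
move=> tL; have /andP[v0 v1] := arch_in q_gt1 b_gt0 bL tL.
have w0 := w_gt0 tL.
have dw : is_derive t 1 w (- q * v t `^ (- q - 1) * dv t - 0).
  apply: (@is_derive1B R (fun t => v t `^ (- q)) (fun=> 1)).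
  exact: is_derive1_powR_comp v0 (is_derive_arch q_gt1 b_gt0 bL tL).
have := is_derive1Z (b `^ (q - 1)) (is_derive1_powR_comp ((q - 1) / q) w0 dw).
congr is_derive; rewrite subr0 (dvE tL) /m.
have -> : (q - 1) / q - 1 = - q^-1 by field; rewrite gt_eqF.
rewrite -(mulr_powRB1 (ltW b_gt0) q_gt0).
have -> : v t `^ (- q) = v t `^ (- q - 1) * v t.
  by rewrite mulrC -[X in X * _](powRr1 (ltW v0)) -powRD ?(gt_eqF v0) ?implybT// addrC subrK.
rewrite powRN; field.
by rewrite !gt_eqF// powR_gt0.
Qed.

(** Equal to [lambda_ T 1 q] when b is [pip q / T]. *)
Let lam := (q - 1) * b `^ q.

(* Picone's identity: the derivative is the deficit in Young's inequality
   between [du] and [u * dv / v]. *)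
Let H t := \int[mu]_(s in `[0, t]) (du s `^ q) -
  lam * \int[mu]_(s in `[0, t]) (u s `^ q) - u t `^ q * riccati t.

Let is_derive_H t : 0 < t < L -> is_derive t 1 H
  (du t `^ q + (q - 1) * (u t * m t) `^ q - q * (u t * m t) `^ (q - 1) * du t).
Proof.
move=> tL; have tLi : t \in `]0, L[%R by rewrite in_itv.
have /andP[u0 u1] := arch_in p_gt1 a_gt0 aL tL.
have /andP[v0 v1] := arch_in q_gt1 b_gt0 bL tL.
have [_ _ Xd] := primitive_spec L_gt0 (within_continuous_darch_powR p_gt1 q_gt1 a_gt0 aL).
have [_ _ Yd] := primitive_spec L_gt0 (within_continuous_arch_powR p_gt1 q_gt1 a_gt0 aL).
have dud := is_derive_arch p_gt1 a_gt0 aL tL.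
have := is_derive1B (is_derive1B (Xd t tLi) (is_derive1Z lam (Yd t tLi)))
  (is_derive1M (is_derive1_powR_comp q u0 dud) (is_derive_riccati tL)).
congr is_derive; rewrite -/u -/du.
have m0 := ltW (m_gt0 tL).
rewrite (powRM q (ltW u0) m0) (powRM (q - 1) (ltW u0) m0) -(riccatiE tL) (mq tL) /lam /w.
ring.
Qed.

(** The first integral is dropped and the second is at most t because u <= 1. Although [riccati]
    blows up at 0, it is at most of order t^(1-q) by v >= t / L, while u^q <= (a t)^q, so their
    product is of order t. *)
Let H_ge t : 0 < t < L -> - ((lam + a `^ q * b `^ (q - 1) * L `^ (q - 1)) * t) <= H t.
Proof.
move=> /[dup] tL /andP[t0 t1].
have /andP[u0 u1] := arch_in p_gt1 a_gt0 aL tL.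
have /andP[v0 v1] := arch_in q_gt1 b_gt0 bL tL.
have tL' : 0 <= t <= L by rewrite !ltW.
have X0 : 0 <= \int[mu]_(s in `[0, t]) (du s `^ q).
  by apply: Rintegral_ge0 => s _; exact: powR_ge0.
have lam0 : 0 <= lam by rewrite mulr_ge0 ?powR_ge0// subr_ge0 ltW.
have Yt : \int[mu]_(s in `[0, t]) (u s `^ q) <= t.
  pose Y x := \int[mu]_(t in `[0, x]) (u t `^ q).
  have [Y0 Yc Yd] : [/\ Y 0 = 0, {within `[0, L], continuous Y} &
      forall x, x \in `]0, L[%R -> is_derive x 1 Y (u x `^ q)] :=
    primitive_spec L_gt0 (within_continuous_arch_powR p_gt1 q_gt1 a_gt0 aL).
  have Yd' s : s \in `]0, t[%R -> is_derive s 1 Y (u s `^ q).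
    rewrite in_itv/= => /andP[s0 st]; apply: Yd.
    by rewrite in_itv/= s0 (lt_trans st).
  have : Y t - Y 0 <= t - 0.
    apply: (is_derive1_le_le (ltW t0) Yd' (fun s _ => is_derive_id s 1)).
    - apply: continuous_subspaceW Yc.
      by apply: subset_itvl; rewrite bnd_simp ltW.
    - exact: within_continuous_id.
    - move=> s; rewrite in_itv/= => /andP[s0 st]; apply: powR_le1 => //.
      by apply: (arch_bounds p_gt1 a_gt0 aL); rewrite !ltW// (lt_trans st).
  by rewrite Y0 !subr0.
have ur : u t `^ q * riccati t <= a `^ q * b `^ (q - 1) * L `^ (q - 1) * t.
  have rle : riccati t <= b `^ (q - 1) * (L / t) `^ (q - 1).
    rewrite /riccati ler_wpM2l ?powR_ge0//.
    have -> : (L / t) `^ (q - 1) = (L / t) `^ q `^ ((q - 1) / q).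
      by rewrite -powRrM [q * _]mulrCA mulfV ?mulr1// gt_eqF.
    have e0 : 0 <= (q - 1) / q.
      by rewrite divr_ge0 ?(ltW q_gt0)// subr_ge0 (ltW q_gt1).
    rewrite ge0_ler_powR ?nnegrE ?powR_ge0 ?(ltW (w_gt0 tL))//.
    apply: (@le_trans _ _ (v t `^ (- q))); first by rewrite gerBl.
    rewrite powRN -[leRHS]invrK lef_pV2 ?posrE ?invr_gt0 ?powR_gt0 ?divr_gt0//.
    have -> : ((L / t) `^ q)^-1 = (t / L) `^ q.
      by rewrite -(powR_inv1 (powR_ge0 _ _)) powRAC powR_inv1 ?invf_div// ltW// divr_gt0.
    rewrite ge0_ler_powR ?nnegrE ?divr_ge0 ?(ltW q_gt0) ?(ltW t0) ?(ltW L_gt0) ?(ltW v0)//.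
    exact: arch_ge q_gt1 L_gt0 b_gt0 bL _ tL'.
  have ule : u t `^ q <= (a * t) `^ q.
    rewrite ge0_ler_powR ?nnegrE ?(ltW q_gt0) ?(ltW u0) ?mulr_ge0 ?(ltW a_gt0) ?(ltW t0)//.
    exact: arch_le p_gt1 a_gt0 aL _ tL'.
  apply: le_trans (ler_pM _ _ ule rle) _; rewrite ?powR_ge0 ?mulr_ge0 ?powR_ge0//.
  rewrite powRM ?(ltW a_gt0) ?(ltW t0)// powRM ?invr_ge0 ?(ltW L_gt0) ?(ltW t0)//.
  rewrite -(mulr_powRB1 (ltW t0) q_gt0) -(powR_inv1 (ltW t0)) powRAC powR_inv1 ?powR_ge0//.
  rewrite le_eqVlt; apply/orP; left; apply/eqP; field.
  by rewrite gt_eqF// powR_gt0.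
rewrite /H mulrDl opprD; apply: lerB; last exact: ur.
by rewrite -[leLHS]add0r; apply: lerB => //; exact: ler_wpM2l.
Qed.

Let deficit t : R :=
  du t `^ q + (q - 1) * (u t * m t) `^ q - q * (u t * m t) `^ (q - 1) * du t.

Let deficit_gt0 t : 0 < t < L -> du t != u t * m t -> 0 < deficit t.
Proof.
move=> tL neq; have /andP[u0 u1] := arch_in p_gt1 a_gt0 aL tL.
have /andP[d0 d1] := darch_in p_gt1 a_gt0 aL tL.
by rewrite subr_gt0 powR_tangent_lt// mulr_gt0// m_gt0.
Qed.

Let deficit_ge0 t : 0 < t < L -> 0 <= deficit t.
Proof.
move=> tL; have [e|/(deficit_gt0 tL)/ltW//] := eqVneq (du t) (u t * m t).
have /andP[d0 d1] := darch_in p_gt1 a_gt0 aL tL.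
rewrite /deficit -e -mulrA [_ * du t]mulrC (mulr_powRB1 (ltW d0) q_gt0).
rewrite le_eqVlt; apply/orP; left; apply/eqP; ring.
Qed.

Let H_cont s t : 0 < s -> t < L -> {within `[s, t], continuous H}.
Proof.
move=> s0 tL; apply: (@is_derive1_within_continuous R _ deficit) => x.
rewrite in_itv/= => /andP[sx xt]; apply: is_derive_H.
by rewrite (lt_le_trans s0)// (le_lt_trans xt).
Qed.

Let H_le s t : 0 < s -> s <= t -> t < L -> H s <= H t.
Proof.
move=> s0 st tL.
have xL x : x \in `]s, t[%R -> 0 < x < L.
  by rewrite in_itv/= => /andP[sx xt]; rewrite (lt_trans s0)// (lt_trans xt).
apply: (is_derive1_ge0_le st (fun x xst => is_derive_H (xL x xst))).
- exact: H_cont.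
- by move=> x /xL; exact: deficit_ge0.
Qed.

Let H_ge0 t : 0 < t < L -> 0 <= H t.
Proof.
move=> /andP[t0 tL]; rewrite leNgt; apply/negP => Ht.
set K := lam + a `^ q * b `^ (q - 1) * L `^ (q - 1).
have K0 : 0 < K.
  by rewrite addr_gt0 ?mulr_gt0 ?powR_gt0 ?subr_gt0.
(* For this s, -K s >= H t / 2 > H t, against -K s <= H s <= H t. *)
pose s := Num.min t (- H t / (2 * K)).
have s0 : 0 < s by rewrite lt_min t0 divr_gt0 ?mulr_gt0// oppr_gt0.
have st : s <= t by rewrite ge_min lexx.
have sL : 0 < s < L by rewrite s0 (le_lt_trans st).
have := le_trans (H_ge sL) (H_le s0 st tL); rewrite -/K lerNl => Ks.
have : s <= - H t / (2 * K) by rewrite ge_min lexx orbT.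
rewrite ler_pdivlMr ?mulr_gt0// mulrCA [s * K]mulrC => Ks'.
have : 2 * - H t <= - H t by apply: le_trans Ks'; rewrite ler_pM2l.
by rewrite leNgt ltr_pMl ?oppr_gt0// ltr1n.
Qed.

Let exists_H_gt0 : exists2 t, 0 < t < L & 0 < H t.
Proof.
apply: contrapT => Hle.
have H0 t : 0 < t < L -> H t = 0.
  move=> tL; apply/eqP; rewrite eq_le (H_ge0 tL) andbT leNgt.
  by apply/negP => Ht; apply: Hle; exists t.
have duE t : 0 < t < L -> du t = u t * m t.
  move=> tL; apply/eqP; apply: contrapT => /negP neq.
  have dH := is_derive_H tL; rewrite -/(deficit t) in dH.
  have d0 : is_derive t 1 H 0.
    apply: (@is_derive1_eq_near _ (fun=> 0)) (is_derive_cst (0 : R) t (1 : R)).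
    near=> x; rewrite H0//.
    have : x \in `]0, L[%R by near: x; apply: near_in_itvoo; rewrite in_itv.
    by rewrite in_itv.
  have := deficit_gt0 tL neq.
  by rewrite -(@derive_val _ _ _ _ _ _ _ dH) (@derive_val _ _ _ _ _ _ _ d0) ltxx.
have v_gt0 t : 0 < t -> t <= L -> 0 < v t.
  move=> t0 tL; apply: lt_le_trans (arch_ge q_gt1 L_gt0 b_gt0 bL (_ : 0 <= t <= L)).
    exact: divr_gt0.
  by rewrite ltW.
(* The quotient u / v has zero derivative, and its value at [L] is 1. *)
have uvE t : 0 < t < L -> u t = v t.
  move=> /andP[t0 tL].
  have xL x : x \in `]t, L[%R -> 0 < x < L.
    by rewrite in_itv/= => /andP[tx ->]; rewrite (lt_trans t0).
  have d x : x \in `]t, L[%R -> is_derive x 1 (fun x => u x * (v x)^-1) 0.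
    move=> /xL x0L; have /andP[x0 xltL] := x0L.
    have vx0 : v x != 0 by rewrite gt_eqF// v_gt0// ltW.
    have := is_derive1M (is_derive_arch p_gt1 a_gt0 aL x0L)
      (is_deriveV vx0 (is_derive_arch q_gt1 b_gt0 bL x0L)).
    congr is_derive; rewrite -/(du x) -/(dv x) (duE x x0L) (dvE x0L) /GRing.scale/=.
    by rewrite -/(u x) -/(v x); field.
  have c : {within `[t, L], continuous (fun x => u x * (v x)^-1)}.
    have sub : `[t, L] `<=` `[0, L] by apply: subset_itvr; rewrite bnd_simp ltW.
    apply: within_continuousM.
      exact: continuous_subspaceW sub (within_continuous_arch p_gt1 a_gt0 aL).
    have cv := continuous_subspaceW sub (within_continuous_arch q_gt1 b_gt0 bL).
    (* A point outside the segment is isolated in the subspace topology, so continuity is trivial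
       there, whatever the value of v. *)
    move=> x; have [xtL|xtL] := pselect (`[t, L] x); last first.
      rewrite /continuous_at; case: (nbhs_subspaceP `[t, L] x) => // _.
      by move=> A /nbhs_singleton Ax y ->.
    apply: (@continuousV _ _ (from_subspace `[t, L] v)); last exact: cv.
    rewrite gt_eqF//; move: xtL; rewrite /= in_itv/= => /andP[tx xL'].
    by rewrite v_gt0// (lt_le_trans t0).
  have [x _] := MVT tL d c; rewrite mul0r => /eqP; rewrite subr_eq0.
  rewrite /u /v (archL p_gt1 aL) (archL q_gt1 bL) divr1 -/(u t) -/(v t) => /eqP e.
  by rewrite -[v t]mul1r e divfK// gt_eqF// v_gt0// ltW.
have dudv t : 0 < t < L -> du t = dv t.
  by move=> tL; rewrite duE// dvE// uvE.
(* The slopes are known to agree only inside the interval; their values at 0 are limits from the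
   right. *)
have dudv0 : du 0 = dv 0.
  have [_ du0 _] := (continuous_within_itvP du L_gt0).1
    (within_continuous_darch p_gt1 a_gt0 aL).
  have [_ dv0 _] := (continuous_within_itvP dv L_gt0).1
    (within_continuous_darch q_gt1 b_gt0 bL).
  apply: (cvg_unique (@norm_hausdorff _ R) du0).
  apply: cvg_trans dv0; apply: near_eq_cvg; near=> x.
  apply/esym/dudv/andP; split; first by near: x; exact: nbhs_right_gt.
  by near: x; exact: nbhs_right_lt.
by move: ab; rewrite -(darch0 a p_gt1) -(darch0 b q_gt1) -/(du 0) dudv0 ltxx.
Unshelve. all: by end_near. Qed.

(** The boundary term of [H] is nonnegative, so for t0 < t < L the difference of the integrals up to
    t is at least [H t] >= [H t0] > 0. Continuity of the integrals carries the bound [H t0] to t =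
    [L], keeping the inequality strict. *)
Lemma rayleigh_lower_bound :
  (q - 1) * b `^ q * \int[mu]_(t in `[0, L]) (arch p a t `^ q) <
  \int[mu]_(t in `[0, L]) (darch p a t `^ q).
Proof.
have [_ Xc _] := primitive_spec L_gt0 (within_continuous_darch_powR p_gt1 q_gt1 a_gt0 aL).
have [_ Yc _] := primitive_spec L_gt0 (within_continuous_arch_powR p_gt1 q_gt1 a_gt0 aL).
have Ec := within_continuousD Xc (within_continuousN (within_continuousMl (k := lam) Yc)).
have [_ _ EL] := (continuous_within_itvP _ L_gt0).1 Ec.
have [t0 /andP[t0_gt0 t0L] Ht0] := exists_H_gt0.
rewrite -subr_gt0; apply: lt_le_trans Ht0 _; rewrite leNgt; apply/negP => lt_H.
near L^'- => t.
have : \int[mu]_(s in `[0, t]) (du s `^ q) +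
    - (lam * \int[mu]_(s in `[0, t]) (u s `^ q)) < H t0.
  by near: t; apply: (cvgr_lt _ EL).
have t0t : t0 < t by near: t; exact: nbhs_left_gt.
have tL : t < L by near: t; exact: nbhs_left_lt.
rewrite ltNge => /negP; apply; apply: le_trans (H_le t0_gt0 (ltW t0t) tL) _.
by rewrite gerBl mulr_ge0 ?powR_ge0// mulr_ge0 ?powR_ge0.
Unshelve. all: by end_near. Qed.

End Picone.
End Rayleigh.

(** * The norms as integrals over the half interval *)

Section Norms.
Context {R : realType}.
Local Open Scope classical_set_scope.
Notation mu := (@lebesgue_measure R).

Lemma norm_Lr_powR (T q : R) (f : R -> R) : 0 < q ->
  (norm_Lr T q f `^ q = \int[mu]_(t in `]0%R, T[) (`|f t| `^ q)%:E)%E.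
Proof.
move=> q0; rewrite /norm_Lr powR_Lnorm; last exact: lt0r_neq0.
rewrite [RHS]integral_mkcond.
apply: eq_integral => t _; rewrite /= /patch; case: (t \in _) => //.
by rewrite /= normr0 powR0// gt_eqF.
Qed.

Lemma integral_reflection (k : R -> R) (L : R) : 0 < L ->
  {within `[0, L], continuous k} ->
  (\int[mu]_(t in `[L, (L + L)%R]) (k (L + L - t))%:E =
   \int[mu]_(t in `[0%R, L]) (k t)%:E)%E.
Proof.
move=> L0 kc.
pose F (t : R) := L + L - t.
have Fd (t : R) : is_derive t 1 F (- 1) by exact: is_derive1_cBid.
have F' : F^`() = cst (- 1).
  by apply/funext => t; rewrite derive1E derive_val.
have FL : F L = L by rewrite /F addrK.
have F0 : F 0 = L + L by rewrite /F subr0.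
have Fc : continuous F by move=> t; exact: is_derive1_continuous (Fd t).
(* [F] is an involution exchanging [0, L] and [L, 2 L], so the substitution turns [k \o F] back into
   [k]. *)
have := @integration_by_substitution_decreasing R F (k \o F) 0 L (ltW L0).
rewrite FL F0 => ->.
- apply: eq_integral => t _; rewrite F' /= /F; congr EFin.
  by rewrite opprK mulr1; congr k; ring.
- by move=> x y _ _; rewrite /F ltrD2l ltrN2.
- by rewrite F' => ? _; exact: cvg_cst.
- by rewrite F'; exact: is_cvg_cst.
- by rewrite F'; exact: is_cvg_cst.
- split => //.
  + by apply: cvg_at_right_filter; exact: Fc.
  + by apply: cvg_at_left_filter; exact: Fc.
- apply: (@within_continuous_comp_sub _ _ `[0, L] F k) => //.
    exact: continuous_subspaceT.
  by move=> t /=; rewrite /F !in_itv/= => /andP[]; lra.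
Qed.

(** Apart from its sign, [h L] is left free, a single point being negligible: no derivative has to
    be computed at the top of the arch. Measurability of [h] comes from its agreement with [k] and
    the reflection of [k]. *)
Lemma integral_even (h k : R -> R) (L : R) : 0 < L ->
  {within `[0, L], continuous k} -> (forall t, 0 <= h t) ->
  (forall t, 0 < t < L -> h t = k t) ->
  (forall t, L < t < L + L -> h t = k (L + L - t)) ->
  (\int[mu]_(t in `]0%R, (L + L)%R[) (h t)%:E =
   (2 * \int[mu]_(t in `[0, L]) k t)%:E)%E.
Proof.
move=> L0 kc h0 hk hk'.
have k'c : {within `[L, L + L], continuous (fun t => k (L + L - t))}.
  apply: (@within_continuous_comp_sub _ _ `[0, L] (fun t => L + L - t) k) => //.
    by apply: continuous_subspaceT => t; exact: is_derive1_continuous (is_derive1_cBid t _).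
  by move=> t /=; rewrite !in_itv/= => /andP[]; lra.
have mk : measurable_fun `]0, L[ k.
  apply: subspace_continuous_measurable_fun => //.
  by apply: continuous_subspaceW kc; exact: subset_itv_oo_cc.
have mk' : measurable_fun `]L, L + L[ (fun t => k (L + L - t)).
  apply: subspace_continuous_measurable_fun => //.
  by apply: continuous_subspaceW k'c; exact: subset_itv_oo_cc.
have mh : measurable_fun `]0, L[ h.
  by apply: eq_measurable_fun mk => t; rewrite inE/= in_itv/= => /hk.
have mh' : measurable_fun `]L, L + L[ h.
  by apply: eq_measurable_fun mk' => t; rewrite inE/= in_itv/= => /hk'.
have ki : mu.-integrable `[0, L] (EFin \o k).
  by apply: continuous_compact_integrable => //; exact: segment_compact.
have -> : `]0, L + L[ = `]0, L[ `|` `[L, L + L[ :> set R.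
  by apply: itv_bndbnd_setU; rewrite bnd_simp ?lerDl// ltW.
rewrite ge0_integral_setU//=; last 3 first.
- apply/measurable_funU => //; split; first exact/measurable_EFinP.
  by apply/emeasurable_fun_itv_obnd_cbndP/measurable_EFinP.
- by move=> t _; rewrite lee_fin.
- apply/disj_setPS => t [/=]; rewrite !in_itv/= => /andP[_ tL] /andP[Lt _].
  by move: (lt_le_trans tL Lt); rewrite ltxx.
have -> : (\int[mu]_(t in `]0%R, L[) (h t)%:E = \int[mu]_(t in `[0%R, L]) (k t)%:E)%E.
  rewrite [RHS]integral_itv_bndoo//; last exact/measurable_EFinP.
  by apply: eq_integral => t; rewrite inE/= in_itv/= => /hk ->.
have -> : (\int[mu]_(t in `[L, (L + L)%R[) (h t)%:E = \int[mu]_(t in `[0%R, L]) (k t)%:E)%E.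
  rewrite integral_itv_bndoo//; last exact/measurable_EFinP.
  rewrite -integral_reflection// [RHS]integral_itv_bndoo//; last exact/measurable_EFinP.
  by apply: eq_integral => t; rewrite inE/= in_itv/= => /hk' ->.
rewrite -(fineK (integrable_fin_num _ ki))// -EFinD.
by congr EFin; rewrite /Rintegral; ring.
Qed.

(** On [0, T[ the floor in [sinp] is 0, and the minimum folds the right half of the arch onto the
    left half. *)
Lemma phiE (T r t : R) : 1 < r -> 0 < T -> 0 <= t < T ->
  phi T r t = arch r (pip r / T) (Num.min t (T - t)).
Proof.
move=> r1 T0 /andP[t0 tT]; have pr0 := pip_gt0 r1.
rewrite /phi /sinp.
have -> : pip r * t / T / pip r = t / T by field; rewrite !gt_eqF.
have -> : Num.floor (t / T) = 0.
  apply/eqP; rewrite floor_eq add0r divr_ge0 ?(ltW T0)//=.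
  by rewrite ltr_pdivrMr// mul1r.
have c0 : 0 <= pip r / T by rewrite divr_ge0// ltW.
rewrite expr0z mul1r mul0r subr0 /arch minr_pMr//.
congr (sinp_quarter r (Num.min _ _)); first by rewrite mulrAC.
by field; rewrite gt_eqF.
Qed.

Section NormsOfPhi.
Variables (p q L : R).
Hypotheses (p_gt1 : 1 < p) (q_gt1 : 1 < q) (L_gt0 : 0 < L).

Let T := L + L.
Let c := pip p / T.

Let T_gt0 : 0 < T. Proof. exact: addr_gt0. Qed.
Let c_gt0 : 0 < c. Proof. exact: divr_gt0 (pip_gt0 p_gt1) T_gt0. Qed.
Let q_gt0 : 0 < q. Proof. exact: lt_trans ltr01 q_gt1. Qed.

Let cL : c * L = pip p / 2.
Proof. by rewrite /c /T; field; rewrite !gt_eqF. Qed.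

Let phi_left t : 0 < t < L -> phi T p t = arch p c t.
Proof.
move=> /andP[t0 tL].
rewrite phiE//; last by rewrite (ltW t0) (lt_trans tL)// ltrDl.
by rewrite min_l// lerBrDl lerD// ltW.
Qed.

Let phi_right t : L < t < T -> phi T p t = arch p c (T - t).
Proof.
move=> /andP[Lt tT].
rewrite phiE//; last by rewrite tT (le_trans (ltW L_gt0))// ltW.
by rewrite min_r// lerBlDl lerD// ltW.
Qed.

Let reflect_in t : L < t < T -> 0 < T - t < L.
Proof. by move=> /andP[Lt tT]; rewrite subr_gt0 tT/= ltrBlDr ltrD2l. Qed.

Lemma norm_phi_powR :
  (norm_Lr T q (phi T p) `^ q =
   (2 * \int[mu]_(t in `[0%R, L]) (arch p c t `^ q))%:E)%E.
Proof.
have norm_arch t : 0 < t < L -> `|arch p c t| = arch p c t.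
  by move=> /(arch_in p_gt1 c_gt0 cL)/andP[u0 _]; rewrite gtr0_norm.
rewrite (norm_Lr_powR _ _ q_gt0); apply: (integral_even L_gt0).
- exact: within_continuous_arch_powR p_gt1 q_gt1 c_gt0 cL.
- by move=> t; exact: powR_ge0.
- by move=> t tL; rewrite phi_left// norm_arch.
- by move=> t tL; rewrite phi_right// norm_arch// reflect_in.
Qed.

(** Inside each half, [phi] agrees locally with the arch or its reflection, which determines the
    derivative; the sign produced by the reflection disappears in the absolute value. *)
Lemma norm_dphi_powR :
  (norm_Lr T q (derive1 (phi T p)) `^ q =
   (2 * \int[mu]_(t in `[0%R, L]) (darch p c t `^ q))%:E)%E.
Proof.
have norm_darch t : 0 < t < L -> `|darch p c t| = darch p c t.
  by move=> /(darch_in p_gt1 c_gt0 cL)/andP[u0 _]; rewrite gtr0_norm.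
rewrite (norm_Lr_powR _ _ q_gt0); apply: (integral_even L_gt0).
- exact: within_continuous_darch_powR p_gt1 q_gt1 c_gt0 cL.
- by move=> t; exact: powR_ge0.
- move=> t tL; rewrite derive1E.
  have d : is_derive t 1 (phi T p) (darch p c t).
    apply: is_derive1_eq_near (is_derive_arch p_gt1 c_gt0 cL tL).
    near=> x; rewrite phi_left//.
    have : x \in `]0, L[%R by near: x; apply: near_in_itvoo; rewrite in_itv.
    by rewrite in_itv.
  by rewrite (@derive_val _ _ _ _ _ _ _ d) norm_darch.
- move=> t tL; rewrite derive1E.
  have d : is_derive t 1 (phi T p) (darch p c (T - t) * - 1).
    apply: (@is_derive1_eq_near _ (fun t => arch p c (T - t))); last first.
      have tL' := reflect_in tL.
      exact: (@is_derive1_composite R (arch p c) (fun t => T - t) t _ _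
        (is_derive_arch p_gt1 c_gt0 cL tL')) (is_derive1_cBid t T).
    near=> x; rewrite phi_right//.
    have : x \in `]L, T[%R by near: x; apply: near_in_itvoo; rewrite in_itv.
    by rewrite in_itv.
  by rewrite (@derive_val _ _ _ _ _ _ _ d) mulrN1 normrN norm_darch// reflect_in.
Unshelve. all: by end_near. Qed.

End NormsOfPhi.
End Norms.

(** * Comparison of the constants pi_r and conclusion *)

(** With x = pi / r, [pip r] is 2 x / sin x, which increases with x on (0, pi). *)
Lemma pip_lt (R : realType) (p q : R) : 1 < q -> q < p -> pip p < pip q.
Proof.
move=> q1 qp; have p1 : 1 < p := lt_trans q1 qp.
have pipE (r : R) : 1 < r -> pip r = 2 * ((pi / r) / sin (pi / r)).
  move=> r1; have s0 := sin_pi_div_gt0 r1; rewrite /pip.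
  by field; rewrite !gt_eqF//; exact: lt_trans ltr01 r1.
have p0 : 0 < p := lt_trans ltr01 p1.
have q0 : 0 < q := lt_trans ltr01 q1.
rewrite !pipE// ltr_pM2l//; apply: ltr_x_div_sin.
- by rewrite divr_gt0// pi_gt0.
- by rewrite ltr_pM2l ?pi_gt0// ltf_pV2.
- by rewrite ltr_pdivrMr// ltr_pMr// pi_gt0.
Qed.

(** Follows from sin (pi / q) = sin (pi - pi / q) <= pi (q - 1) / q. *)
Lemma pip_ge (R : realType) (q : R) : 1 < q -> 2 <= (q - 1) * pip q.
Proof.
move=> q1; have q0 : 0 < q := lt_trans ltr01 q1.
have s0 := sin_pi_div_gt0 q1.
have e : pi - pi / q = pi * (q - 1) / q by field; rewrite gt_eqF.
have : sin (pi / q) <= pi * (q - 1) / q.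
  have -> : sin (pi / q) = sin (pi - pi / q).
    by rewrite sinB sinpi cospi mul0r sub0r mulN1r opprK.
  rewrite -e; apply: sin_le_id; rewrite e divr_ge0 ?(ltW q0)// mulr_ge0 ?pi_ge0//.
  by rewrite subr_ge0 ltW.
rewrite ler_pdivlMr// => le_s.
rewrite /pip mulrA ler_pdivlMr ?mulr_gt0//.
move: le_s; move: (sin (pi / q)) (pi : R) => s x.
by lra.
Qed.

Theorem lemma4p2 (R : realType) (T p q : R)
    (T_gt0 : 0 < T) (q_gt1 : 1 < q) (q_lt_p : q < p) :
  ((lambda_ T 1 q)%:E <
     norm_Lr T q (derive1 (phi T p)) `^ q / norm_Lr T q (phi T p) `^ q <
   (lambda_ T 2 q)%:E)%E.
Proof.
have p_gt1 : 1 < p := lt_trans q_gt1 q_lt_p.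
have q_gt0 : 0 < q := lt_trans ltr01 q_gt1.
have L_gt0 : 0 < T / 2 by rewrite divr_gt0.
have TE : T = T / 2 + T / 2 by field.
have aL : pip p / T * (T / 2) = pip p / 2 by field; rewrite gt_eqF.
have bL : pip q / T * (T / 2) = pip q / 2 by field; rewrite gt_eqF.
have a_gt0 : 0 < pip p / T by rewrite divr_gt0// pip_gt0.
have b_gt0 : 0 < pip q / T by rewrite divr_gt0// pip_gt0.
have ab : pip p / T < pip q / T by rewrite ltr_pM2r ?invr_gt0// pip_lt.
have lower := rayleigh_lower_bound p_gt1 q_gt1 L_gt0 a_gt0 ab aL bL.
have X_lt := integral_darch_lt p_gt1 q_gt1 L_gt0 a_gt0 aL.
have Y_ge := integral_arch_ge p_gt1 q_gt1 L_gt0 a_gt0 aL.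
have nX := norm_dphi_powR p_gt1 q_gt1 L_gt0.
have nY := norm_phi_powR p_gt1 q_gt1 L_gt0.
rewrite -TE in nX nY; move: nX nY lower X_lt Y_ge.
set X := Rintegral _ _ (fun t => darch _ _ _ `^ _).
set Y := Rintegral _ _ _ => -> -> lower X_lt Y_ge.
have Y_gt0 : 0 < Y by apply: lt_le_trans Y_ge; rewrite divr_gt0// addr_gt0.
(* The factors 2 from the two halves cancel, and Y > 0 makes the extended quotient a real one. *)
have -> : ((2 * X)%:E / (2 * Y)%:E = (X / Y)%:E)%E.
  rewrite inver mulf_eq0 (gt_eqF Y_gt0) pnatr_eq0/= -EFinM; congr EFin.
  by field; rewrite gt_eqF.
rewrite /lambda_ !lte_fin; apply/andP; split.
  rewrite (ltr_pdivlMr _ _ Y_gt0) [1 * pip q]mul1r; exact: lower.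
(* It remains to bound ([pip p / T])^(q-1) by [lambda_ T 2 q * Y]; [pip p] is first replaced by the
   larger [pip q]. *)
rewrite (ltr_pdivrMr _ _ Y_gt0); apply: lt_le_trans X_lt _.
set b := pip q / T in ab b_gt0 lower *.
have -> : 2 * pip q / T = 2 * b by rewrite /b mulrA.
apply: (@le_trans _ _ (b `^ (q - 1))).
  by rewrite ge0_ler_powR ?nnegrE ?subr_ge0 ?(ltW q_gt1) ?(ltW a_gt0) ?(ltW b_gt0) ?(ltW ab).
rewrite (powRM q (ler0n R 2) (ltW b_gt0)) -(mulr_powRB1 (ltW b_gt0) q_gt0).
(* Bernoulli's inequality at x = 2. *)
have q2 : q + 1 <= 2 `^ q.
  have := bernoulli_powR_lt q_gt1 (ltr0Sn R 1).
  have -> : (2 : R) != 1 by rewrite (eqr_nat _ 2 1).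
  by move=> /(_ isT)/ltW; apply: le_trans; rewrite addrC -[2]natr1 addrK mulr1.
have k_gt0 : 0 < (q - 1) * b by rewrite mulr_gt0 ?subr_gt0.
have kT : 2 <= (q - 1) * b * T.
  by rewrite -mulrA /b mulfVK ?pip_ge// gt_eqF.
have q1_gt0 : 0 < q + 1 by rewrite addr_gt0.
(* What is left after division by b^(q-1). It follows from 2^q >= q + 1, Y >= (T / 2) / (q + 1) and
   (q - 1) b T >= 2. *)
suff one_le : 1 <= (q - 1) * b * (2 `^ q * Y).
  have -> : (q - 1) * (2 `^ q * (b * b `^ (q - 1))) * Y =
      (q - 1) * b * (2 `^ q * Y) * b `^ (q - 1) by ring.
  by rewrite ler_peMl ?powR_ge0.
apply: (@le_trans _ _ ((q - 1) * b * ((q + 1) * (T / 2 / (q + 1))))).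
  rewrite [(q + 1) * _]mulrC mulfVK ?gt_eqF// mulrA ler_pdivlMr// mul1r.
  exact: kT.
rewrite ler_pM2l//; apply: ler_pM => //; first exact: ltW.
by rewrite ltW// divr_gt0.
Qed.
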